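(* Let $f_1:(M_1,\nabla_{M_1})\to(B,\nabla_B)$ and $f_2:(M_2,\nabla_{M_2})\to(B,\nabla_B)$ be two affine bundles with the same base, with compact and complete total spaces, whose fibres are diffeomorphic and have the same linear holonomy, and such that the fundamental groups of both total spaces are the same group $\pi_1(M)$ (as extension of $\pi_1(B)$ by $\pi_1(F)$). Then $f_1$ is isomorphic to $f_2$ if and only if there exists an isomorphism between the affine bundles $\hat f_1$ and $\hat f_2$ over an automorphism of $(B,\nabla_B)$, a lift of which to $\mathbb{R}^n$ conjugates the linear holonomy of $(M_1,\nabla_{M_1})$ to that of $(M_2,\nabla_{M_2})$, transforms $[C_1]$ into $[C_2]$, and transforms $[D_1]$ into $[D_2]$.
   Context: An affine manifold $(M,\nabla_M)$ is a connected differentiable manifold with a connection whose curvature and torsion vanish. The structure lifts to the universal cover $\hat M$ and is given by a local affine diffeomorphism $D_M:\hat M\to\mathbb{R}^n$ (developing map); the holonomy $h_M:\pi_1(M)\to\mathrm{Aff}(\mathbb{R}^n)$ satisfies $D_M\circ\gamma=h_M(\gamma)\circ D_M$; its linear part is the linear holonomy $L(h_M)$. $M$ is complete if $D_M$ is a diffeomorphism onto $\mathbb{R}^n$. An affine bundle is a surjective affine map $f:(M,\nabla_M)\to(B,\nabla_B)$, assumed to be a locally trivial differentiable fibration with connected typical fibre $F$. An isomorphism of affine bundles is an affine isomorphism of total spaces sending fibres to fibres. When $M$ is compact and complete, $\pi_1(M)$ is an extension of $\pi_1(B)$ by $\pi_1(F)$. Write $\mathbb{R}^n=\mathbb{R}^m\oplus\mathbb{R}^l$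 with $m=\dim B$ and $\mathbb{R}^l$ the direction of the lifted fibres. Then for $\gamma\in\pi_1(M)$ $$h_M(\gamma)(x,y)=(A_\gamma(x)+a_\gamma,\,B_\gamma(y)+C_\gamma(x)+d_\gamma),$$ with $A_\gamma,B_\gamma,C_\gamma$ linear. The quotient of $\mathbb{R}^n$ by $h_M(\pi_1(F))$ is an affine bundle over $\mathbb{R}^m$, denoted $\hat f$. The space of linear maps $\mathrm{Applin}(\mathbb{R}^m,\mathbb{R}^l)$ is a $\mathbb{Z}\pi_1(M)$-bimodule with left action $\gamma\cdot C=B_\gamma C$ and right action $C\cdot\gamma=C A_\gamma$; $C:\gamma\mapsto C_\gamma$ is a Hochschild $1$-cocycle, $C_{\gamma\gamma'}=B_\gamma C_{\gamma'}+C_\gamma A_{\gamma'}$, and $[C]$ is its class modulo the maps $\gamma\mapsto B_\gamma E-E A_\gamma$ with $E\in\mathrm{Applin}(\mathbb{R}^m,\mathbb{R}^l)$. $D:\pi_1(M)\to\mathbb{R}^l$ is the map $D(\gamma)=d_\gamma$, and $[D]$ is its class modulo the coboundaries $\gamma\mapsto B_\gamma(e)-e$, $e\in\mathbb{R}^l$, for the left action of $\pi_1(M)$ on $\mathbb{R}^l$ by $B_\gamma$. For $f_i$ these objects carry the index $i$. Let $k$ be an affine automorphism of $\mathbb{R}^n$ lifting an isomorphism $\hat f_1\to\hat f_2$ and projecting on $\mathbb{R}^m$ to a lift $k'$ of an automorphism of $(B,\nabla_B)$. The conditions on $k$ are understood relative to an automorphism $\varphi$ of $\pi_1(M)$ which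 induces on $\pi_1(B)$ the conjugation by $k'$ and on $\pi_1(F)$ the map induced by $k$. ''$k$ conjugates the linear holonomy of $M_1$ to that of $M_2$'' means $L(h_{M_2})(\varphi(\gamma))=L(k)L(h_{M_1})(\gamma)L(k)^{-1}$ for all $\gamma\in\pi_1(M)$, where $L(k)$ is the linear part of $k$. ''$k$ transforms $[C_1]$ into $[C_2]$, and $[D_1]$ into $[D_2]$'' means that the corresponding components $C$ and $D$ of the representation $\varphi(\gamma)\mapsto k\,h_{M_1}(\gamma)\,k^{-1}$ have classes $[C_2]$ and $[D_2]$ respectively. *)

(* Defs.v *)
From HB Require Import structures.
From mathcomp Require Import all_boot all_order all_algebra.
From mathcomp Require Import all_classical all_reals all_analysis.

Set Implicit Arguments.
Unset Strict Implicit.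
Unset Printing Implicit Defensive.

Import Order.TTheory GRing.Theory Num.Theory.
Import numFieldNormedType.Exports.

Local Open Scope classical_set_scope.
Local Open Scope ring_scope.

(* R^n is ['cV[R]_n], so that the linear part of an affine map acts by left
   multiplication. *)

(** ** Smooth maps between open subsets of normed spaces *)

Fixpoint Ck (R : realType) (V W : normedModType R) (k : nat) (U : set V)
    (F : V -> W) : Prop :=
  if k is k'.+1 then
    (forall x, U x -> differentiable F x) /\
    (forall v, Ck k' U (fun x => 'd F x v))
  else forall x, U x -> {for x, continuous F}.

(* Only used for open [U]. *)
Definition smooth_on (R : realType) (V W : normedModType R) (U : set V)
    (F : V -> W) : Prop := forall k, Ck k U F.

(** ** Manifolds *)

(* The maps of a chart are total functions; they are only meaningful on
   [cdom] and [cran] respectively. *)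
Record chart (R : realType) (T : Type) (n : nat) := Chart {
  cdom : set T;
  cmap : T -> 'cV[R]_n;
  cinv : 'cV[R]_n -> T }.

Definition cran (R : realType) (T : Type) (n : nat) (c : chart R T n) :
  set 'cV[R]_n := cmap c @` cdom c.

Record is_chart (R : realType) (T : topologicalType) (n : nat)
    (c : chart R T n) : Prop := IsChart {
  chart_open_dom : open (cdom c);
  chart_open_ran : open (cran c);
  chart_invK : forall x, cdom c x -> cinv c (cmap c x) = x;
  chart_cont : forall x, cdom c x -> {for x, continuous (cmap c)};
  chart_inv_cont : forall u, cran c u -> {for u, continuous (cinv c)} }.

Record charted (R : realType) (n : nat) := Charted {
  csort :> topologicalType;
  atlas : set (chart R csort n) }.
Arguments atlas {R n} _ _.

(* The expression of [f] in the charts [c], [c']. *)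
Definition rep (R : realType) (S T : Type) (m n : nat) (c : chart R S m)
  (c' : chart R T n) (f : S -> T) : 'cV[R]_m -> 'cV[R]_n :=
  fun u => cmap c' (f (cinv c u)).

(* Smoothness of [f] on the open subset [A] of [X]. *)
Definition smooth_map_on (R : realType) (m n : nat) (X : charted R m)
    (Y : charted R n) (A : set X) (f : X -> Y) : Prop :=
  (forall x, A x -> {for x, continuous f}) /\
  (forall c c', atlas X c -> atlas Y c' ->
     smooth_on (cmap c @` (A `&` cdom c `&` f @^-1` cdom c')) (rep c c' f)).

Definition smooth_map (R : realType) (m n : nat) (X : charted R m)
  (Y : charted R n) (f : X -> Y) : Prop := smooth_map_on setT f.

Record smooth_manifold (R : realType) (n : nat) (X : charted R n) : Prop :=
  SmoothManifold {
  sm_hausdorff : hausdorff_space X;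
  sm_second_countable : @second_countable X;
  sm_chart : forall c, atlas X c -> is_chart c;
  sm_cover : forall x : X, exists2 c, atlas X c & cdom c x;
  sm_transition : forall c c', atlas X c -> atlas X c' ->
    smooth_on (cmap c @` (cdom c `&` cdom c')) (rep c c' id) }.

Definition diffeo (R : realType) (m n : nat) (X : charted R m)
    (Y : charted R n) (f : X -> Y) : Prop :=
  exists g : Y -> X,
    [/\ cancel f g, cancel g f, smooth_map f & smooth_map g].

Definition local_diffeo (R : realType) (m n : nat) (X : charted R m)
    (Y : charted R n) (f : X -> Y) : Prop :=
  smooth_map f /\
  forall x : X, exists (U : set X) (g : Y -> X),
    [/\ open U, U x, open (f @` U), smooth_map_on (f @` U) g
      & forall y, U y -> g (f y) = y].

Definition prod_chart (R : realType) (S T : Type) (m n : nat)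
  (c : chart R S m) (c' : chart R T n) : chart R (S * T) (m + n) :=
  Chart (cdom c `*` cdom c')
    (fun z => col_mx (cmap c z.1) (cmap c' z.2))
    (fun u => (cinv c (usubmx u), cinv c' (dsubmx u))).

Definition prod_charted (R : realType) (m n : nat) (X : charted R m)
  (Y : charted R n) : charted R (m + n) :=
  @Charted R (m + n) (X * Y)%type
    [set e | exists c c', [/\ atlas X c, atlas Y c' & e = prod_chart c c']].

(** ** Connections and affine manifolds *)

(* [chr X c u i j k] is the Christoffel symbol Gamma^k_{ij} at the point of
   coordinates [u] in the chart [c]: nabla_{d_i} d_j = sum_k Gamma^k_{ij} d_k.
   It is only meaningful for [u] in [cran c]. *)
Record conn_mfd (R : realType) (n : nat) := ConnMfd {
  mfd :> charted R n;
  chr : chart R mfd n -> 'cV[R]_n -> 'I_n -> 'I_n -> 'I_n -> R }.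
Arguments chr {R n} _ _ _ _ _ _.

Definition christoffel (R : realType) (n : nat)
  (G : 'cV[R]_n -> 'I_n -> 'I_n -> 'I_n -> R) (x u v : 'cV[R]_n) : 'cV[R]_n :=
  \col_k \sum_(i < n) \sum_(j < n) G x i j k * u i 0 * v j 0.

(* F_* (nabla_u V) = nabla'_{F_* u} (F_* V) at [x], for constant vector
   fields [V = v]: the condition for [F] to preserve the connections with
   Christoffel symbols [G] and [G']. *)
Definition preserves_conn (R : realType) (m n : nat)
    (G : 'cV[R]_m -> 'I_m -> 'I_m -> 'I_m -> R)
    (G' : 'cV[R]_n -> 'I_n -> 'I_n -> 'I_n -> R)
    (F : 'cV[R]_m -> 'cV[R]_n) (x : 'cV[R]_m) : Prop :=
  forall u v : 'cV[R]_m,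
    'd F x (christoffel G x u v) =
    'd (fun y => 'd F y v) x u + christoffel G' (F x) ('d F x u) ('d F x v).

Definition affine_map (R : realType) (m n : nat) (X : conn_mfd R m)
    (Y : conn_mfd R n) (f : X -> Y) : Prop :=
  smooth_map f /\
  forall c c' x, atlas X c -> atlas Y c' -> cdom c x -> cdom c' (f x) ->
    preserves_conn (chr X c) (chr Y c') (rep c c' f) (cmap c x).

Definition torsion (R : realType) (n : nat)
  (G : 'cV[R]_n -> 'I_n -> 'I_n -> 'I_n -> R) (x : 'cV[R]_n)
  (i j k : 'I_n) : R := G x i j k - G x j i k.

(* The [d_l] component of R(d_i, d_j) d_k. *)
Definition curvature (R : realType) (n : nat)
  (G : 'cV[R]_n -> 'I_n -> 'I_n -> 'I_n -> R) (x : 'cV[R]_n)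
  (i j k l : 'I_n) : R :=
  'd (fun y => G y j k l : R^o) x (delta_mx i 0)
  - 'd (fun y => G y i k l : R^o) x (delta_mx j 0)
  + \sum_(p < n) (G x i p l * G x j k p - G x j p l * G x i k p).

Record affine_manifold (R : realType) (n : nat) (X : conn_mfd R n) : Prop :=
  AffineManifold {
  am_smooth : smooth_manifold X;
  am_connected : connected [set: X];
  am_chr_smooth : forall (c : chart R X n) i j k, atlas X c ->
    smooth_on (cran c) (fun u => chr X c u i j k : R^o);
  (* the Christoffel symbols in two charts define the same connection *)
  am_chr_compat : forall (c c' : chart R X n) x, atlas X c -> atlas X c' ->
    cdom c x -> cdom c' x ->
    preserves_conn (chr X c) (chr X c') (rep c c' id) (cmap c x);
  am_torsion : forall (c : chart R X n) u i j k, atlas X c -> cran c u ->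
    torsion (chr X c) u i j k = 0;
  am_curvature : forall (c : chart R X n) u i j k l, atlas X c -> cran c u ->
    curvature (chr X c) u i j k l = 0 }.

Definition affine_isom (R : realType) (m n : nat) (X : conn_mfd R m)
    (Y : conn_mfd R n) (f : X -> Y) : Prop :=
  exists g : Y -> X,
    [/\ cancel f g, cancel g f, affine_map f & affine_map g].

(* R^n with its standard flat connection. *)
Definition Rn (R : realType) (n : nat) : conn_mfd R n :=
  @ConnMfd R n (@Charted R n 'cV[R]_n [set Chart setT id id])
    (fun _ _ _ _ _ => 0).

(** ** Universal cover, developing map, holonomy *)

Definition covering_map (X Y : topologicalType) (p : X -> Y) : Prop :=
  continuous p /\
  forall y : Y, exists U : set Y, [/\ open U, U y &
    exists (I : Type) (V : I -> set X) (s : I -> Y -> X),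
      [/\ inhabited I, p @^-1` U = \bigcup_i V i, trivIset setT V
        & forall i, [/\ open (V i),
            forall u, U u -> {for u, continuous (s i)},
            forall u, U u -> V i (s i u) /\ p (s i u) = u
          & forall x, V i x -> s i (p x) = x]]].

Definition path_connected_space (R : realType) (X : topologicalType) : Prop :=
  forall x y : X, exists g : R -> X,
    [/\ {within `[0, 1], continuous g}, g 0 = x & g 1 = y].

Definition null_homotopic (R : realType) (X : topologicalType) (g : R -> X) :=
  exists H : R * R -> X,
    [/\ {within `[0, 1] `*` `[0, 1], continuous H},
        forall s, s \in `[0, 1] -> H (s, 0) = g s /\ H (s, 1) = g 0
      & forall t, t \in `[0, 1] -> H (0, t) = g 0 /\ H (1, t) = g 0].

Definition simply_connected (R : realType) (X : topologicalType) : Prop :=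
  path_connected_space R X /\
  forall g : R -> X, {within `[0, 1], continuous g} -> g 0 = g 1 ->
    null_homotopic g.

Record development (R : realType) (n : nat) (M : conn_mfd R n) :=
  Development {
  ucov :> conn_mfd R n;
  uproj : ucov -> M;
  dev : ucov -> Rn R n }.
Arguments uproj {R n M} {_} _.
Arguments dev {R n M} {_} _.

Record is_development (R : realType) (n : nat) (M : conn_mfd R n)
    (U : development M) : Prop := IsDevelopment {
  ucov_affine : affine_manifold U;
  ucov_simply_connected : simply_connected R U;
  uproj_covering : covering_map (@uproj R n M U);
  uproj_affine : affine_map (@uproj R n M U);
  uproj_local_diffeo : local_diffeo (@uproj R n M U);
  dev_affine : affine_map (@dev R n M U);
  dev_local_diffeo : local_diffeo (@dev R n M U) }.

Definition complete_affine (R : realType) (n : nat) (M : conn_mfd R n)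
  (U : development M) : Prop := diffeo (@dev R n M U).

Definition deck (R : realType) (n : nat) (M : conn_mfd R n)
    (U : development M) (d : U -> U) : Prop :=
  [/\ continuous d, (exists d' : U -> U,
        [/\ cancel d d', cancel d' d & continuous d'])
    & forall x, uproj (d x) = uproj x].

(* [rho] identifies the group [P] with the fundamental group of [M], acting
   on the universal cover by deck transformations. *)
Record is_pi1 (R : realType) (n : nat) (M : conn_mfd R n)
    (U : development M) (P : groupType) (rho : P -> U -> U) : Prop := IsPi1 {
  pi1_mul : forall g g' x, rho (g * g')%g x = rho g (rho g' x);
  pi1_inj : injective rho;
  pi1_range : range rho = [set d | deck d] }.

Record aff (R : realType) (n : nat) := Aff {
  lin : 'M[R]_n;
  trans : 'cV[R]_n }.

Definition app (R : realType) (n : nat) (k : aff R n) (x : 'cV[R]_n) :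
  'cV[R]_n := lin k *m x + trans k.

Definition is_aut (R : realType) (n : nat) (k : aff R n) : bool :=
  lin k \in unitmx.

(* k h k^-1 *)
Definition aff_conj (R : realType) (n : nat) (k h : aff R n) : aff R n :=
  let L := lin k *m lin h *m invmx (lin k) in
  Aff L (lin k *m trans h + trans k - L *m trans k).

Definition is_holonomy (R : realType) (n : nat) (M : conn_mfd R n)
    (U : development M) (P : groupType) (rho : P -> U -> U)
    (h : P -> aff R n) : Prop :=
  forall g, is_aut (h g) /\ forall x : U, dev (rho g x) = app (h g) (dev x).

(* Components of (x, y) |-> (A x + a, B y + C x + d) on R^m (+) R^l. *)
Definition Apart (R : realType) (m l : nat) (h : aff R (m + l)) : 'M[R]_m :=
  ulsubmx (lin h).
Definition Bpart (R : realType) (m l : nat) (h : aff R (m + l)) : 'M[R]_l :=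
  drsubmx (lin h).
Definition Cpart (R : realType) (m l : nat) (h : aff R (m + l)) :
  'M[R]_(l, m) := dlsubmx (lin h).
Definition dpart (R : realType) (m l : nat) (h : aff R (m + l)) : 'cV[R]_l :=
  dsubmx (trans h).

(* [C'] and [C] have the same class modulo g |-> B_g E - E A_g. *)
Definition same_classC (R : realType) (m l : nat) (P : Type)
    (A : P -> 'M[R]_m) (B : P -> 'M[R]_l) (C' C : P -> 'M[R]_(l, m)) : Prop :=
  exists E : 'M[R]_(l, m), forall g, C' g - C g = B g *m E - E *m A g.

(* [D'] and [D] have the same class modulo g |-> B_g e - e. *)
Definition same_classD (R : realType) (l : nat) (P : Type)
    (B : P -> 'M[R]_l) (D' D : P -> 'cV[R]_l) : Prop :=
  exists e : 'cV[R]_l, forall g, D' g - D g = B g *m e - e.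

(** ** Affine bundles *)

Definition locally_trivial (R : realType) (m l : nat) (M : conn_mfd R (m + l))
    (B : conn_mfd R m) (F : charted R l) (f : M -> B) : Prop :=
  forall b : B, exists (U : set B) (psi : prod_charted B F -> M) (chi : M -> F),
    [/\ open U, U b,
        smooth_map_on (X := prod_charted B F) (U `*` [set: F]) psi,
        smooth_map_on (f @^-1` U) chi
      & (forall u z, U u -> f (psi (u, z)) = u /\ chi (psi (u, z)) = z) /\
        (forall x, U (f x) -> psi (f x, chi x) = x)].

Record affine_bundle (R : realType) (m l : nat) (M : conn_mfd R (m + l))
    (B : conn_mfd R m) (F : charted R l) (f : M -> B) : Prop := AffineBundle {
  ab_total : affine_manifold M;
  ab_base : affine_manifold B;
  ab_affine : affine_map f;
  ab_surj : range f = [set: B];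
  ab_fibre : smooth_manifold F;
  ab_fibre_connected : connected [set: F];
  ab_trivial : locally_trivial F f }.

Definition bundle_isom (R : realType) (n m : nat) (X Y : conn_mfd R n)
    (B B' : conn_mfd R m) (p : X -> B) (q : Y -> B') (Phi : X -> Y) : Prop :=
  affine_isom Phi /\
  forall b, exists b', Phi @` (p @^-1` [set b]) = q @^-1` [set b'].

(* [E], with projection [q], is the affine manifold quotient of R^n by the
   group [h @` N]. *)
Definition is_quotient (R : realType) (n : nat) (P : Type) (h : P -> aff R n)
    (N : set P) (E : conn_mfd R n) (q : Rn R n -> E) : Prop :=
  [/\ affine_manifold E, affine_map q, local_diffeo q, range q = [set: E]
    & forall v w, q v = q w <-> exists2 g, N g & w = app (h g) v].

(* pi_1(F), as the kernel of the surjection of pi_1(M) onto pi_1(B). *)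
Definition piF (P PB : groupType) (pr : P -> PB) : set P :=
  [set g | pr g = 1%g].

Record is_extension (P PB : groupType) (pr : P -> PB) : Prop := IsExtension {
  ext_mul : {morph pr : x y / (x * y)%g};
  ext_surj : range pr = [set: PB] }.

(* The objects attached to one affine bundle [f] with compact complete total
   space: development [U] of M, lift [tf] of [f] to the universal covers,
   coordinates R^m (+) R^l adapted to [tf], fundamental group and holonomy, and
   the affine bundle [fh] over R^m (the paper's f hat), whose total space [E]
   is the quotient of R^(m+l) by the holonomy of pi_1(F). *)
Record bundle_setting (R : realType) (m l : nat) (B : conn_mfd R m)
    (UB : development B) (P PB : groupType) (rhoB : PB -> UB -> UB)
    (pr : P -> PB)
    (M : conn_mfd R (m + l)) (F : charted R l) (f : M -> B)
    (U : development M) (tf : U -> UB) (rho : P -> U -> U)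
    (h : P -> aff R (m + l))
    (E : conn_mfd R (m + l)) (q : Rn R (m + l) -> E) (fh : E -> Rn R m) :
    Prop := BundleSetting {
  bs_bundle : affine_bundle F f;
  bs_compact : compact [set: M];
  bs_development : is_development U;
  bs_complete : complete_affine U;
  bs_lift_cont : continuous tf;
  bs_lift : forall x, uproj (tf x) = f (uproj x);
  bs_adapted : forall x, dev (tf x) = usubmx (dev x : 'cV[R]_(m + l));
  bs_pi1 : is_pi1 rho;
  bs_extension : forall g x, tf (rho g x) = rhoB (pr g) (tf x);
  bs_holonomy : is_holonomy rho h;
  bs_quotient : is_quotient h (piF pr) q;
  bs_hat : forall v : 'cV[R]_(m + l), fh (q v) = usubmx v }.

(* The linear holonomy of a fibre is g |-> B_g for g in pi_1(F): g acts on the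
   leaf {x} x R^l of the lifted fibration by y |-> B_g y + (C_g x + d_g).  It is
   defined up to the choice of linear coordinates on R^l. *)
Definition same_fibre_holonomy (R : realType) (m l : nat) (P : Type)
    (N : set P) (h1 h2 : P -> aff R (m + l)) : Prop :=
  exists2 S : 'M[R]_l, S \in unitmx &
    forall g, N g -> Bpart (h2 g) = S *m Bpart (h1 g) *m invmx S.

(* [k'] is a lift to R^m of an automorphism of B; [kB] is the same lift, seen
   on the universal cover of B. *)
Definition lifts_aut (R : realType) (m : nat) (B : conn_mfd R m)
    (UB : development B) (k' : aff R m) (kB : UB -> UB) : Prop :=
  [/\ is_aut k', continuous kB, (forall x, dev (kB x) = app k' (dev x))
    & exists2 beta : B -> B, affine_isom beta &
        forall x, uproj (kB x) = beta (uproj x)].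

(* Main.v *)
(* Since the total spaces are complete, each [M] is the quotient of R^(m+l) by
   the holonomy group, [p : R^(m+l) -> M] being an affine local diffeomorphism;
   the base is complete as well and is the quotient of R^m.

   An affine map of R^(m+l) into [M] lifts through [p] to an affine map of
   R^(m+l): locally this is flatness, and since R^(m+l) is connected and [M]
   is Hausdorff the local lifts fit together.  Hence a bundle isomorphism lifts
   to an affine [k] conjugating [h1] to [h2] along an automorphism [phi], and
   everything else descends from [k], with trivial coboundaries.

   Conversely, if [k] conjugates the linear parts and acts on the base by [k'],
   then [k h1 k^-1] and [h2 o phi] only differ in their [D] components, by a
   coboundary [B e - e]; composing [k] with the translation by [(0, e)] gives
   an affine map that conjugates [h1] to [h2 o phi], hence descends to M1 -> M2. *)
Require Import Defs.
From HB Require Import structures.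
From mathcomp Require Import all_boot all_order all_algebra.
From mathcomp Require Import all_classical all_reals all_analysis.

Set Implicit Arguments.
Unset Strict Implicit.
Unset Printing Implicit Defensive.

Import Order.TTheory GRing.Theory Num.Theory.
Import numFieldNormedType.Exports.

Local Open Scope classical_set_scope.
Local Open Scope ring_scope.

(** * Iterated differentiability *)

(** A first-order expansion depends only on the germ at [x]. This moves differentials between total
    functions that agree only near the points that matter, such as chart expressions. *)
Lemma near_eq_is_diff (K : numFieldType) (V W : normedModType K)
    (f g df : V -> W) (x : V) :
  {near x, f =1 g} -> is_diff x f df -> is_diff x g df.
Proof.
move=> fg [/diff_locallyP[dfc fE] dfE].
have gE : g \o shift x = cst (g x) + 'd f x +o_ 0 id.
  apply/eqaddoP => e e0; move/eqaddoP: fE => /(_ e e0).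
  have : \forall y \near (0 : V), f (y + x) = g (y + x).
    have : \forall y \near x, f y = g y by exact: fg.
    by rewrite (near_shift 0 x) subr0.
  rewrite -(nbhs_singleton fg).
  apply: filterS2 => y E.
  by rewrite !fctE /= E.
have gdE : 'd g x = 'd f x :> (V -> W) by apply: diff_unique.
split; last by rewrite gdE.
by apply/diff_locallyP; rewrite gdE.
Qed.

Lemma open_eq_near (T : topologicalType) (S : Type) (U : set T) (F G : T -> S) x :
  open U -> {in U, F =1 G} -> U x -> {near x, F =1 G}.
Proof.
move=> oU FG Ux.
have : \forall y \near x, U y by apply: open_nbhs_nbhs; split.
by apply: filterS => y Uy; apply: FG; rewrite inE.
Qed.

(** * First and second derivatives: sums, products, composites *)

Section differentials.
Context {K : numFieldType}.
Implicit Types V W : normedModType K.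

Lemma is_diffE V W (F dF : V -> W) x u :
  is_diff x F dF -> 'd F x u = dF u.
Proof. by case=> _ ->. Qed.

Lemma scaler_is_bilinear W :
  bilinear_for
    (GRing.Scale.Law.clone _ _ *:%R _) (GRing.Scale.Law.clone _ _ *:%R _)
    (fun (a : K) (w : W) => a *: w).
Proof.
split=> [u'|u] a x y /=.
- by rewrite scalerDl scalerA.
- by rewrite scalerDr !scalerA mulrC.
Qed.

(** The product rule as a chain rule: scaling is packaged as a continuous bilinear map, whose
    differential is known. *)
Lemma is_diff_scale V W (a da : V -> K) (b db : V -> W) x :
  is_diff x a da -> is_diff x b db ->
  is_diff x (fun y => a y *: b y) (fun v => a x *: db v + da v *: b x).
Proof.
move=> dax dbx.
pose bM := bilinear_isBilinear.Build K K W W _ _ _ (@scaler_is_bilinear W).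
pose bL : {bilinear K -> W -> W} := HB.pack (fun (a : K) (w : W) => a *: w) bM.
have cL : continuous (fun p => bL p.1 p.2) by exact: scale_continuous.
have -> : (fun y => a y *: b y) =
  (fun p => bL p.1 p.2) \o (fun y => (a y, b y)) by [].
have dbL : is_diff (a x, b x) (fun p => bL p.1 p.2)
    (fun q => bL (a x) q.2 + bL q.1 (b x)).
  by split; [exact: differentiable_bilin|rewrite diff_bilin].
exact: is_diff_comp.
Qed.

Lemma coord_is_linear n (i : 'I_n) : linear (fun u : 'cV[K]_n => u i 0 : K).
Proof. by move=> a u v; rewrite !mxE. Qed.

Lemma linear_col_sum n W (L : {linear 'cV[K]_n -> W}) (u : 'cV[K]_n) :
  L u = \sum_i u i 0 *: L (delta_mx i 0).
Proof.
rewrite {1}[u]matrix_sum_delta linear_sum.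
by apply: eq_bigr => i _; rewrite big_ord1 linearZ.
Qed.

Lemma is_diff_sum (V W : normedModType K) (I : Type) (r : seq I)
    (F dF : I -> V -> W) x :
  (forall i, is_diff x (F i) (dF i)) ->
  is_diff x (fun y => \sum_(i <- r) F i y) (fun v => \sum_(i <- r) dF i v).
Proof.
move=> dFP; elim: r => [|i r IH].
  under eq_fun do rewrite big_nil.
  by under [X in is_diff_def _ _ X]eq_fun do rewrite big_nil; exact: is_diff_cst.
under eq_fun do rewrite big_cons.
under [X in is_diff_def _ _ X]eq_fun do rewrite big_cons.
exact: is_diffD.
Qed.

Lemma is_diff_coord (V : normedModType K) n (F dF : V -> 'cV[K]_n) x i :
  is_diff x F dF -> is_diff x (fun y => F y i 0 : K) (fun v => dF v i 0 : K).
Proof.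
pose cM := GRing.isLinear.Build _ _ _ _ _ (@coord_is_linear n i).
pose cL : {linear 'cV[K]_n -> K} := HB.pack (fun u : 'cV[K]_n => u i 0 : K) cM.
have cc : continuous cL by exact: coord_continuous.
move=> dFx.
have dL : is_diff (F x) cL cL.
  by split; [exact: linear_differentiable|exact: diff_lin].
exact: (is_diff_comp dFx dL).
Qed.

(* [d1 v] is the derivative of [F] along [v] at [x], and [d2 u v] that of
   [fun y => 'd F y v] along [u]. *)
Definition jet2 V W (F : V -> W) (x : V) (d1 : V -> W) (d2 : V -> V -> W) :=
  [/\ \forall y \near x, differentiable F y, is_diff x F d1
    & forall v, is_diff x (fun y => 'd F y v) (d2^~ v)].

Lemma jet2D V W (F : V -> W) x d1 d2 :
  jet2 F x d1 d2 -> {morph d1 : u v / u + v}.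
Proof. by move=> [_ dF _] u v; rewrite -!(is_diffE _ dF) linearD. Qed.

Lemma near_eq_jet2 V W (F G : V -> W) x d1 d2 :
  {near x, F =1 G} -> jet2 F x d1 d2 -> jet2 G x d1 d2.
Proof.
move=> FG [dF d1F d2F].
have FGd : \forall y \near x, is_diff y G ('d F y).
  (* Second derivatives require ['d F] and ['d G] to agree at all points near [x], hence equality of
     germs at each such point. *)
  have := near_join (FG : \forall y \near x, F y = G y).
  apply: filterS2 dF => y dFy FGy.
  exact: near_eq_is_diff (FGy : {near y, F =1 G}) (differentiableP dFy).
split=> [||v].
- by apply: filterS FGd => y [].
- exact: near_eq_is_diff d1F.
- apply: near_eq_is_diff (d2F v).
  suff : \forall y \near x, 'd F y v = 'd G y v by [].
  by apply: filterS FGd => y dGy; exact/esym/(is_diffE v dGy).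
Qed.

Lemma jet2_linear V W (L : {linear V -> W}) x :
  continuous L -> jet2 L x L (fun _ _ => 0).
Proof.
move=> cL; have dL y : is_diff y L L.
  by split; [exact: linear_differentiable|exact: diff_lin].
split=> [||v]; [by near=> y; have [] := dL y|exact: dL|].
have d0 : is_diff x (cst (L v : W)) (0 : V -> W) by exact: is_diff_cst.
apply: near_eq_is_diff d0.
by near=> y; exact/esym/(is_diffE v (dL y)).
Unshelve. all: by end_near. Qed.

(** Second-order chain rule. In ['d G (F y) ('d F y v)] the linear map and its argument both vary
    with [y]; expanding the argument in the standard basis leaves a finite sum of products, to which
    the product rule applies. *)
Lemma jet2_comp V W n (F : V -> 'cV[K]_n) (G : 'cV[K]_n -> W) x
    (d1 : V -> 'cV[K]_n) (d2 : V -> V -> 'cV[K]_n)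
    (e1 : 'cV[K]_n -> W) (e2 : 'cV[K]_n -> 'cV[K]_n -> W) :
  jet2 F x d1 d2 -> jet2 G (F x) e1 e2 ->
  jet2 (G \o F) x (e1 \o d1) (fun u v => e2 (d1 u) (d1 v) + e1 (d2 u v)).
Proof.
move=> [dF d1F d2F] [dG d1G d2G].
have cF : {for x, continuous F}.
  exact/differentiable_continuous/(nbhs_singleton dF).
have dGF : \forall y \near x, differentiable G (F y) by exact: (cF _ dG).
split=> [||v].
- by apply: filterS2 dF dGF => y dFy dGy; exact: differentiable_comp.
- exact: is_diff_comp.
(* Linearity of [e2] in its second argument is not part of [jet2]; it is recovered from the
   uniqueness of differentials. *)
pose e2sum (c w : 'cV[K]_n) := \sum_i c i 0 *: e2 w (delta_mx i 0).
have e2E c w : e2 w c = e2sum c w.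
  rewrite -(is_diffE w (d2G c)).
  suff dd : is_diff (F x) (fun z => 'd G z c) (e2sum c) by exact: is_diffE w dd.
  under eq_fun do rewrite linear_col_sum.
  by apply: is_diff_sum => i; exact: is_diffZ (d2G (delta_mx i 0)).
have e1E w : e1 w = \sum_i w i 0 *: e1 (delta_mx i 0).
  rewrite -(is_diffE w d1G) linear_col_sum; apply: eq_bigr => i _.
  by congr (_ *: _); exact: is_diffE d1G.
suff H : is_diff x (fun y => \sum_i ('d F y v) i 0 *: 'd G (F y) (delta_mx i 0))
    (fun u => \sum_i (d1 v i 0 *: e2 (d1 u) (delta_mx i 0)
                      + d2 u v i 0 *: e1 (delta_mx i 0))).
  apply: is_diff_eq (near_eq_is_diff _ H) _; last first.
    by apply/funext => u; rewrite e2E e1E -big_split.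
  suff : \forall y \near x, \sum_i ('d F y v) i 0 *: 'd G (F y) (delta_mx i 0)
                           = 'd (G \o F) y v by [].
  apply: filterS2 dF dGF => y dFy dGy.
  rewrite (is_diffE v (is_diff_comp (differentiableP dFy) (differentiableP dGy))).
  exact/esym/linear_col_sum.
apply: is_diff_sum => i.
have dGi : is_diff x (fun y => 'd G (F y) (delta_mx i 0))
    ((e2^~ (delta_mx i 0)) \o d1).
  exact: (is_diff_comp (g := fun z => 'd G z (delta_mx i 0)) d1F (d2G _)).
apply: is_diff_eq (is_diff_scale (is_diff_coord i (d2F v)) dGi) _; apply/funext => u /=.
congr (_ *: _ + _ *: _); last exact: (is_diffE _ d1G).
exact: (congr1 (fun w : 'cV[K]_n => w i 0) (is_diffE v d1F)).
Qed.

End differentials.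

(** * Closure properties of maps of class C^k *)

Section Ck_theory.
Context {R : realType}.
Implicit Types (V W : normedModType R) (k : nat).

Lemma Ck_sub V W k (U U' : set V) (F : V -> W) :
  U `<=` U' -> Ck k U' F -> Ck k U F.
Proof.
move=> UU'; elim: k F => [|k IH] F /=; first by move=> cF x /UU' /cF.
by case=> dF ddF; split=> [x /UU'/dF //|v]; apply: IH.
Qed.

(** Each clause of [Ck] is a condition at a single point, so it can be checked inside a set that
    changes with the point. *)
Lemma Ck_local V W k (U : set V) (F : V -> W) :
  (forall x, U x -> exists2 A : set V, A x & Ck k A F) -> Ck k U F.
Proof.
move=> loc; elim: k F loc => [|k IH] F /= loc.
  by move=> x /loc[A Ax]; apply.
split=> [x /loc[A Ax [dF _]]|v]; first exact: dF.
by apply: IH => x /loc[A Ax [_ ddF]]; exists A.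
Qed.

Lemma CkS V W k (U : set V) (F : V -> W) : Ck k.+1 U F -> Ck k U F.
Proof.
elim: k F => [|k IH] F /= [dF ddF].
  by move=> x /dF; exact: differentiable_continuous.
by split=> // v; exact: IH.
Qed.

Lemma Ck_eq V W k (U : set V) (F G : V -> W) :
  open U -> {in U, F =1 G} -> Ck k U F -> Ck k U G.
Proof.
move=> oU; elim: k F G => [|k IH] F G FG /=.
  move=> cF x Ux; have nFG := open_eq_near oU FG Ux.
  suff : G y @[y --> x] --> F x by rewrite (nbhs_singleton nFG).
  apply: cvg_trans (cF x Ux); apply: near_eq_cvg.
  by apply: filterS nFG => y.
have dFG x : U x -> differentiable F x -> is_diff x G ('d F x).
  by move=> Ux /differentiableP; apply/near_eq_is_diff/(open_eq_near oU FG).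
case=> dF ddF; split=> [x Ux|v]; first by have [] := dFG _ Ux (dF _ Ux).
apply: IH (ddF v) => x; rewrite inE => Ux.
exact/esym/(is_diffE v (dFG _ Ux (dF _ Ux))).
Qed.

(** Allows an explicit formula [dF] instead of ['d F]; most closure properties below are inductions
    on the order through this rule. *)
Lemma CkS_intro V W k (U : set V) (F : V -> W) (dF : V -> V -> W) :
  open U -> (forall x, U x -> is_diff x F (dF x)) ->
  (forall v, Ck k U (fun x => dF x v)) -> Ck k.+1 U F.
Proof.
move=> oU dFP CdF; split=> [x /dFP[]//|v].
by apply: Ck_eq (CdF v) => // x; rewrite inE => /dFP[_ ->].
Qed.

Lemma Ck_cst V W k (U : set V) (c : W) : open U -> Ck k U (cst c : V -> W).
Proof.
move=> oU; elim: k c => [|k IH] c; first by move=> x _; exact: cst_continuous.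
apply: (@CkS_intro _ _ _ _ _ (fun _ => 0)) => // v.
exact: (IH 0).
Qed.

Lemma Ck_linear V W W' k (U : set V) (F : V -> W) (L : {linear W -> W'}) :
  open U -> continuous L -> Ck k U F -> Ck k U (L \o F).
Proof.
move=> oU cL; elim: k F => [|k IH] F.
  by move=> cF x Ux; apply: continuous_comp; [exact: cF|exact: cL].
case=> dF ddF; apply: (@CkS_intro _ _ _ _ _ (fun x => L \o 'd F x)) => //.
  move=> x /dF /differentiableP dFx; apply: is_diff_comp.
  by split; [exact: linear_differentiable|exact: diff_lin].
by move=> v; exact: (IH _ (ddF v)).
Qed.

Lemma CkD V W k (U : set V) (F G : V -> W) :
  open U -> Ck k U F -> Ck k U G -> Ck k U (fun x => F x + G x).
Proof.
move=> oU; elim: k F G => [|k IH] F G.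
  by move=> cF cG x Ux; apply: continuousD; [exact: cF|exact: cG].
move=> [dF ddF] [dG ddG].
apply: (@CkS_intro _ _ _ _ _ (fun x v => 'd F x v + 'd G x v)) => //.
  by move=> x Ux; apply: is_diffD; apply: differentiableP; [exact: dF|exact: dG].
by move=> v; exact: (IH _ _ (ddF v) (ddG v)).
Qed.

Lemma Ck_sum V W k (U : set V) (I : Type) (r : seq I) (F : I -> V -> W) :
  open U -> (forall i, Ck k U (F i)) -> Ck k U (fun x => \sum_(i <- r) F i x).
Proof.
move=> oU CF; elim: r => [|i r IH].
  by under eq_fun do rewrite big_nil; exact: Ck_cst.
by under eq_fun do rewrite big_cons; apply: CkD.
Qed.

Lemma CkZ V W k (U : set V) (a : V -> R) (F : V -> W) :
  open U -> Ck k U a -> Ck k U F -> Ck k U (fun x => a x *: F x).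
Proof.
move=> oU; elim: k a F => [|k IH] a F.
  by move=> ca cF x Ux; apply: continuousZ; [exact: ca|exact: cF].
move=> Ca CF; have [[da dda] [dF ddF]] := (Ca, CF).
apply: (@CkS_intro _ _ _ _ _ (fun x v => a x *: 'd F x v + 'd a x v *: F x)) => //.
  move=> x Ux; apply: is_diff_scale; apply: differentiableP.
    exact: da.
  exact: dF.
by move=> v; apply: CkD => //; [apply: IH (ddF v)|apply: IH (dda v) _] => //; exact: CkS.
Qed.

Lemma Ck_coord V n k (U : set V) (F : V -> 'cV[R]_n) i :
  open U -> Ck k U F -> Ck k U (fun x => F x i 0 : R).
Proof.
move=> oU CF.
pose cM := GRing.isLinear.Build _ _ _ _ _ (@coord_is_linear R n i).
pose cL : {linear 'cV[R]_n -> R} := HB.pack (fun u : 'cV[R]_n => u i 0 : R) cM.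
apply: (@Ck_linear _ _ _ _ _ F cL) => //.
exact: coord_continuous.
Qed.

(** As for second derivatives, the basis expansion turns each directional derivative of the
    composite into a sum of products, whose factors are of class C^k by the induction hypothesis. *)
Lemma Ck_comp V W n k (U : set V) (U' : set 'cV[R]_n)
    (F : V -> 'cV[R]_n) (G : 'cV[R]_n -> W) :
  open U -> F @` U `<=` U' -> Ck k U F -> Ck k U' G -> Ck k U (G \o F).
Proof.
move=> oU FU; have {}FU x : U x -> U' (F x) by move=> Ux; apply: FU; exists x.
elim: k F G FU => [|k IH] F G FU.
  by move=> cF cG x Ux; apply: continuous_comp; [exact: cF|exact/cG/FU].
move=> CF CG; have [[dF ddF] [dG ddG]] := (CF, CG).
apply: (@CkS_intro _ _ _ _ _ (fun x => 'd G (F x) \o 'd F x)) => //.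
  move=> x Ux; apply: is_diff_comp; apply: differentiableP; first exact: dF.
  exact/dG/FU.
move=> v /=; under eq_fun do rewrite linear_col_sum.
apply: Ck_sum => // i; apply: CkZ => //; first exact: Ck_coord oU (ddF v).
by apply: (IH F _ FU _ (ddG (delta_mx i 0))) => //; exact: CkS.
Qed.

End Ck_theory.

(** * Maps preserving Christoffel symbols *)

Section connections.
Context {R : realType}.

Lemma christoffel0 n (x u v : 'cV[R]_n) : christoffel (fun _ _ _ _ => 0) x u v = 0.
Proof.
apply/matrixP => i j; rewrite !mxE big1// => a _; rewrite big1// => b _.
by rewrite !mul0r.
Qed.

Definition has_jet2 m n (F : 'cV[R]_m -> 'cV[R]_n) (x : 'cV[R]_m) :=
  exists (d1 : 'cV[R]_m -> 'cV[R]_n) (d2 : 'cV[R]_m -> 'cV[R]_m -> 'cV[R]_n),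
    jet2 F x d1 d2.

Lemma smooth_has_jet2 m n (U : set 'cV[R]_m) (F : 'cV[R]_m -> 'cV[R]_n) x :
  open U -> U x -> smooth_on U F -> has_jet2 F x.
Proof.
move=> oU Ux /(_ 2%N)[dF ddF].
exists ('d F x), (fun u v => 'd (fun y => 'd F y v) x u); split.
- have : \forall y \near x, U y by apply: open_nbhs_nbhs; split.
  by apply: filterS => y /dF.
- exact/differentiableP/dF.
- by move=> v; apply/differentiableP/(ddF v).1.
Qed.

(** The condition involves only the first two derivatives at [x], so any 2-jet can replace the
    actual differentials, in particular one obtained from the chain rule. *)
Lemma preserves_connP m n
    (G : 'cV[R]_m -> 'I_m -> 'I_m -> 'I_m -> R)
    (G' : 'cV[R]_n -> 'I_n -> 'I_n -> 'I_n -> R)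
    (F : 'cV[R]_m -> 'cV[R]_n) x
    (d1 : 'cV[R]_m -> 'cV[R]_n) (d2 : 'cV[R]_m -> 'cV[R]_m -> 'cV[R]_n) :
  jet2 F x d1 d2 ->
  preserves_conn G G' F x <->
  forall u v, d1 (christoffel G x u v) =
              d2 u v + christoffel G' (F x) (d1 u) (d1 v).
Proof.
move=> [_ dF d2F].
pose pc (a : 'cV[R]_m -> 'cV[R]_n) (b : 'cV[R]_m -> 'cV[R]_m -> 'cV[R]_n) :=
  forall u v, a (christoffel G x u v) = b u v + christoffel G' (F x) (a u) (a v).
have E1 : ('d F x : 'cV[R]_m -> 'cV[R]_n) = d1 by case: dF.
have E2 : (fun u v => 'd (fun y => 'd F y v) x u) = d2.
  by apply/funext => u; apply/funext => v; exact: is_diffE (d2F v).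
have -> : preserves_conn G G' F x = pc d1 d2 by exact: (f_equal2 pc E1 E2).
by [].
Qed.

Section preserves.
Context {m n p : nat}.
Variables (G : 'cV[R]_m -> 'I_m -> 'I_m -> 'I_m -> R)
          (G' : 'cV[R]_n -> 'I_n -> 'I_n -> 'I_n -> R)
          (G'' : 'cV[R]_p -> 'I_p -> 'I_p -> 'I_p -> R).

Lemma near_eq_preserves (F H : 'cV[R]_m -> 'cV[R]_n) x :
  {near x, F =1 H} -> has_jet2 F x ->
  preserves_conn G G' F x -> preserves_conn G G' H x.
Proof.
move=> FH [d1 [d2 jF]] /(preserves_connP _ _ jF) pF.
apply/(preserves_connP _ _ (near_eq_jet2 FH jF)).
by rewrite -(nbhs_singleton FH).
Qed.

Variables (F : 'cV[R]_m -> 'cV[R]_n) (H : 'cV[R]_n -> 'cV[R]_p) (x : 'cV[R]_m).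
Hypotheses (hF : has_jet2 F x) (hH : has_jet2 H (F x)).

(** Apply the differential of [H] to the equation of [F], then use the equation of [H]: the
    second-order terms are those of the chain rule. *)
Lemma preserves_comp :
  preserves_conn G G' F x -> preserves_conn G' G'' H (F x) ->
  preserves_conn G G'' (H \o F) x.
Proof.
have [d1 [d2 jF]] := hF; have [e1 [e2 jH]] := hH.
move=> /(preserves_connP _ _ jF) pF /(preserves_connP _ _ jH) pH.
apply/(preserves_connP _ _ (jet2_comp jF jH)) => u v /=.
by rewrite pF (jet2D jH) pH addrA [_ + e1 _]addrC.
Qed.

(** Subtracting the image of the equation of [F] from that of [H \o F] leaves the equation of [H] on
    vectors in the image of ['d F x], which is everything. With [H \o F] the identity, this treats
    local inverses. *)
Lemma preserves_cancel :
  (forall w, exists u, 'd F x u = w) ->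
  preserves_conn G G' F x -> preserves_conn G G'' (H \o F) x ->
  preserves_conn G' G'' H (F x).
Proof.
have [d1 [d2 jF]] := hF; have [e1 [e2 jH]] := hH.
move=> sF /(preserves_connP _ _ jF) pF /(preserves_connP _ _ (jet2_comp jF jH)) pHF.
apply/(preserves_connP _ _ jH) => w w'.
have sd1 z : exists u, d1 u = z.
  by case: (sF z) => u <-; exists u; case: jF => _ dF _; exact/esym/(is_diffE u dF).
have [[u <-] [v <-]] := (sd1 w, sd1 w').
have := pHF u v; rewrite /= pF (jet2D jH) -addrA [X in _ = X]addrCA.
by move=> /addrI.
Qed.

End preserves.
End connections.

(** * Affine maps between manifolds *)

Section manifolds.
Context {R : realType}.

(** By the chain rule the differential of [H] at [y] is a right inverse of that of [F], which
    provides the preimage. *)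
Lemma diff_right_inverse m n (F : 'cV[R]_m -> 'cV[R]_n) (H : 'cV[R]_n -> 'cV[R]_m) y :
  has_jet2 H y -> has_jet2 F (H y) -> {near y, F \o H =1 id} ->
  forall w, exists u, 'd F (H y) u = w.
Proof.
move=> [e1 [e2 [_ dH _]]] [d1 [d2 [_ dF _]]] FH w; exists (e1 w).
have d0 : is_diff y (id : 'cV[R]_n -> 'cV[R]_n) (d1 \o e1).
  exact: near_eq_is_diff FH (is_diff_comp dH dF).
apply: etrans (is_diffE (e1 w) dF) _.
exact: etrans (esym (is_diffE w d0)) (is_diffE w (is_diff_id y)).
Qed.

Lemma preserves_id m (G : 'cV[R]_m -> 'I_m -> 'I_m -> 'I_m -> R) x :
  has_jet2 id x /\ preserves_conn G G id x.
Proof.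
have j : jet2 (id : 'cV[R]_m -> 'cV[R]_m) x id (fun _ _ => 0).
  by apply: (@jet2_linear _ _ _ idfun) => ? //.
split; first by exists id, (fun _ _ => 0).
by apply/(preserves_connP _ _ j) => u v; rewrite add0r.
Qed.

Definition good_atlas n (X : charted R n) :=
  (forall c, atlas X c -> is_chart c) /\
  (forall x : X, exists2 c, atlas X c & cdom c x).

Lemma smooth_manifold_good n (X : charted R n) : smooth_manifold X -> good_atlas X.
Proof. by case. Qed.

Lemma affine_manifold_good n (X : conn_mfd R n) : affine_manifold X -> good_atlas X.
Proof. by move=> hX; apply/smooth_manifold_good/am_smooth. Qed.

Lemma openI_preimage (S T : topologicalType) (f : S -> T) (A : set S) (B : set T) :
  open A -> open B -> (forall x, A x -> {for x, continuous f}) ->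
  open (A `&` f @^-1` B).
Proof.
move=> oA oB cf; rewrite openE => x [Ax Bfx]; apply: filterI.
  by apply: open_nbhs_nbhs; split.
by apply: cf => //; apply: open_nbhs_nbhs; split.
Qed.

Lemma chart_open_image (T : topologicalType) n (c : chart R T n) (W : set T) :
  is_chart c -> open W -> W `<=` cdom c -> open (cmap c @` W).
Proof.
move=> hc oW Wc; rewrite openE => _ [x Wx <-].
have cx : cran c (cmap c x) by exists x => //; exact: Wc.
have h1 : nbhs (cmap c x) (cran c).
  by apply: open_nbhs_nbhs; split=> //; exact: chart_open_ran.
have h2 : nbhs (cmap c x) (cinv c @^-1` W).
  apply: (chart_inv_cont hc cx); apply: open_nbhs_nbhs; split=> //.
  by rewrite (chart_invK hc)//; exact: Wc.
apply: filterS2 h1 h2 => _ [z cz <-] /=.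
by rewrite (chart_invK hc)// => Wz; exists z.
Qed.

(** A localised form of [affine_map], since local inverses are meaningful only on an open set. *)
Definition affine_on m n (X : conn_mfd R m) (Y : conn_mfd R n) (A : set X)
    (f : X -> Y) :=
  smooth_map_on A f /\
  forall c c' x, A x -> atlas X c -> atlas Y c' -> cdom c x -> cdom c' (f x) ->
    preserves_conn (chr X c) (chr Y c') (rep c c' f) (cmap c x).

Lemma affine_mapE m n (X : conn_mfd R m) (Y : conn_mfd R n) (f : X -> Y) :
  affine_map f <-> affine_on setT f.
Proof.
by split=> -[sf pf]; split=> // c c' x; [move=> _|move=> *]; apply: pf.
Qed.

Section one_map.
Context {m n : nat} {X : conn_mfd R m} {Y : conn_mfd R n}.
Hypotheses (hX : good_atlas X) (hY : good_atlas Y).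
Implicit Types (A V : set X) (f g : X -> Y).

Lemma rep_dom_open (A : set X) f (c : chart R X m) (c' : chart R Y n) :
  open A -> atlas X c -> atlas Y c' -> (forall x, A x -> {for x, continuous f}) ->
  open (cmap c @` (A `&` cdom c `&` f @^-1` cdom c')).
Proof.
move=> oA Xc Yc' cf; apply: chart_open_image; first exact: hX.1.
- apply: openI_preimage; first by apply: openI => //; exact/chart_open_dom/hX.1.
    exact/chart_open_dom/hY.1.
  by move=> x [/cf].
- by move=> x [[]].
Qed.

Lemma affine_on_jet A f c c' x : open A -> affine_on A f -> A x ->
  atlas X c -> atlas Y c' -> cdom c x -> cdom c' (f x) ->
  has_jet2 (rep c c' f) (cmap c x).
Proof.
move=> oA [[cf sf] _] Ax Xc Yc' cx c'fx.
by apply: smooth_has_jet2 (sf _ _ Xc Yc'); [exact: rep_dom_open|exists x].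
Qed.

Lemma affine_on_sub A V f : V `<=` A -> affine_on A f -> affine_on V f.
Proof.
move=> VA [[cf sf] pf]; split; last by move=> c c' x /VA; exact: pf.
split=> [x /VA/cf//|c c' Xc Yc' k].
apply: Ck_sub (sf _ _ Xc Yc' k) => _ [x [[Vx cx] fx] <-].
by exists x => //; split=> //; split=> //; exact: VA.
Qed.

Lemma affine_on_local A f :
  (forall x, A x -> exists2 V, V x & affine_on V f) -> affine_on A f.
Proof.
move=> loc; split; last first.
  by move=> c c' x /loc[V Vx [_ pf]]; exact: pf.
split=> [x /loc[V Vx [[cf _] _]]|c c' Xc Yc' k]; first exact: cf.
apply: Ck_local => _ [x [[Ax cx] fx] <-].
have [V Vx [[_ sf] _]] := loc _ Ax.
by exists (cmap c @` (V `&` cdom c `&` f @^-1` cdom c')); [exists x|exact: sf].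
Qed.

Lemma affine_on_eq A f g :
  open A -> {in A, f =1 g} -> affine_on A f -> affine_on A g.
Proof.
move=> oA fg hf; have [[cf sf] pf] := hf.
have fgA x : A x -> f x = g x by move=> Ax; apply: fg; rewrite inE.
have cg x : A x -> {for x, continuous g}.
  move=> Ax; suff : g y @[y --> x] --> f x by rewrite fgA.
  apply: cvg_trans (cf x Ax); apply: near_eq_cvg.
  have : \forall y \near x, A y by apply: open_nbhs_nbhs; split.
  by apply: filterS => y /fgA.
have domE (c : chart R X m) (c' : chart R Y n) : cmap c @` (A `&` cdom c `&` f @^-1` cdom c') =
                 cmap c @` (A `&` cdom c `&` g @^-1` cdom c').
  congr image; apply/seteqP; split=> x [[Ax cx] /=].
    by rewrite fgA.
  by rewrite -fgA.
have repE (c : chart R X m) (c' : chart R Y n) : atlas X c ->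
    {in cmap c @` (A `&` cdom c `&` f @^-1` cdom c'), rep c c' f =1 rep c c' g}.
  move=> Xc u; rewrite inE => -[x [[Ax cx] _] <-].
  by rewrite /rep (chart_invK (hX.1 _ Xc))// fgA.
split; first split=> // c c' Xc Yc' k.
  rewrite -domE; apply: Ck_eq (sf _ _ Xc Yc' k); last exact: repE.
  exact: rep_dom_open.
move=> c c' x Ax Xc Yc' cx; rewrite -fgA// => fx.
have jf := affine_on_jet oA hf Ax Xc Yc' cx fx.
apply: near_eq_preserves jf (pf _ _ _ Ax Xc Yc' cx fx).
by apply: (open_eq_near _ (repE c c' Xc)); [exact: rep_dom_open|exists x].
Qed.

End one_map.

Section comp.
Context {m n p : nat} {X : conn_mfd R m} {Y : conn_mfd R n} {Z : conn_mfd R p}.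
Hypotheses (hX : good_atlas X) (hY : good_atlas Y) (hZ : good_atlas Z).
Variables (A : set X) (B : set Y) (f : X -> Y) (g : Y -> Z).
Hypotheses (oA : open A) (oB : open B) (fAB : forall x, A x -> B (f x)).
Hypotheses (hf : affine_on A f) (hg : affine_on B g).

Let cf x : A x -> {for x, continuous f}. Proof. exact: hf.1.1. Qed.
Let cg x : B x -> {for x, continuous g}. Proof. exact: hg.1.1. Qed.

Let dom (c : chart R X m) (d : chart R Y n) (c' : chart R Z p) := cmap c @` ((A `&` cdom c) `&`
  f @^-1` (B `&` cdom d `&` g @^-1` cdom c')).

Let dom_open c d c' : atlas X c -> atlas Y d -> atlas Z c' -> open (dom c d c').
Proof.
move=> Xc Yd Zc'; have oc := chart_open_dom (hX.1 _ Xc).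
apply: chart_open_image; [exact: hX.1| |by move=> x [[]]].
apply: openI_preimage; first exact: openI.
  apply: openI_preimage; first by apply: openI => //; exact/chart_open_dom/hY.1.
    exact/chart_open_dom/hZ.1.
  by move=> y [/cg].
by move=> x [/cf].
Qed.

Let repE c d c' : atlas X c -> atlas Y d ->
  {in dom c d c', rep d c' g \o rep c d f =1 rep c c' (g \o f)}.
Proof.
move=> Xc Yd u; rewrite inE => -[x [[Ax cx] [[Bx dx] gx]] <-].
by rewrite /rep /= (chart_invK (hX.1 _ Xc))// (chart_invK (hY.1 _ Yd)).
Qed.

(** The chart expression of the composite factors through a chart of [Y] around [f x], which varies
    with [x]; smoothness and the connection are therefore both treated near one point at a time. *)
Lemma affine_on_comp : affine_on A (g \o f).
Proof.
split; first split.
- by move=> x Ax; apply: continuous_comp; [exact: cf|exact/cg/fAB].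
- move=> c c' Xc Zc' k; apply: Ck_local => _ [x [[Ax cx] gfx] <-].
  have [d Yd dfx] := hY.2 (f x).
  exists (dom c d c').
    by exists x => //; split=> //; split=> //; split=> //; exact: fAB.
  apply: (Ck_eq _ (@repE c d c' Xc Yd)); first exact: dom_open.
  apply: (@Ck_comp _ _ _ _ _ _ (cmap d @` (B `&` cdom d `&` g @^-1` cdom c'))).
  + exact: dom_open.
  + move=> _ [_ [y [[Ay cy] [[By dy] gy]] <-] <-].
    by exists (f y) => //; rewrite /rep (chart_invK (hX.1 _ Xc)).
  + apply: Ck_sub (hf.1.2 _ _ Xc Yd k) => _ [y [[Ay cy] [[By dy] gy]] <-].
    by exists y.
  + exact: hg.1.2.
- move=> c c' x Ax Xc Zc' cx gfx.
  have [d Yd dfx] := hY.2 (f x).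
  have Bfx := fAB Ax.
  have jf := affine_on_jet hX hY oA hf Ax Xc Yd cx dfx.
  have jg := affine_on_jet hY hZ oB hg Bfx Yd Zc' dfx gfx.
  have repf : rep c d f (cmap c x) = cmap d (f x).
    by rewrite /rep (chart_invK (hX.1 _ Xc)).
  have nE : {near cmap c x, rep d c' g \o rep c d f =1 rep c c' (g \o f)}.
    apply: (open_eq_near _ (@repE c d c' Xc Yd)); first exact: dom_open.
    by exists x.
  rewrite -repf in jg.
  apply: near_eq_preserves nE _ _.
    have [d1 [d2 j1]] := jf; have [e1 [e2 j2]] := jg.
    by do 2 eexists; exact: jet2_comp j1 j2.
  apply: preserves_comp => //; first exact: hf.2.
  by rewrite repf; exact: hg.2.
Qed.

End comp.

Section inverse.
Context {m n : nat} {X : conn_mfd R m} {Y : conn_mfd R n}.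
Hypotheses (hX : good_atlas X) (hY : good_atlas Y).
Variables (p : X -> Y) (U : set X) (g : Y -> X).
Hypotheses (hp : affine_map p) (oU : open U) (opU : open (p @` U)).
Hypotheses (sg : smooth_map_on (p @` U) g) (gK : forall x, U x -> g (p x) = x).

(** In charts, [g \o p] is locally the identity, which preserves the connection, and [p] can be
    cancelled because [p \o g], also locally the identity, makes its differential onto. *)
Lemma affine_local_inverse : affine_on (p @` U) g.
Proof.
split=> // d c _ [x Ux <-] Yd Xc dpx; rewrite gK// => cx.
have hpT := (affine_mapE p).1 hp.
have pUx : (p @` U) (p x) by exists x.
have jp := affine_on_jet hX hY openT hpT I Xc Yd cx dpx.
have jg : has_jet2 (rep d c g) (cmap d (p x)).
  apply: smooth_has_jet2 (sg.2 _ _ Yd Xc).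
    exact: (rep_dom_open hY hX opU Yd Xc sg.1).
  by exists (p x) => //; split=> //=; rewrite gK.
have Ec : rep c d p (cmap c x) = cmap d (p x).
  by rewrite /rep (chart_invK (hX.1 _ Xc)).
have Ed : rep d c g (cmap d (p x)) = cmap c x.
  by rewrite /rep (chart_invK (hY.1 _ Yd))// gK.
have oc := chart_open_dom (hX.1 _ Xc).
have od := chart_open_dom (hY.1 _ Yd).
rewrite -Ec; apply: (preserves_cancel (G := chr X c)).
- exact: jp.
- by rewrite Ec.
- rewrite -Ed; apply: diff_right_inverse => //; first by rewrite Ed.
  pose W := (p @` U `&` cdom d) `&` g @^-1` cdom c.
  apply: (@open_eq_near _ _ (cmap d @` W)).
  + exact: (rep_dom_open hY hX opU Yd Xc sg.1).
  + move=> v; rewrite inE => -[_ [[[z Uz <-] dz] /= cz] <-].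
    by rewrite /rep /= (chart_invK (hY.1 _ Yd))// (chart_invK (hX.1 _ Xc))// gK.
  + by exists (p x) => //; split=> //=; rewrite gK.
- exact: hp.2.
have [ji pid] := preserves_id (chr X c) (cmap c x).
apply: near_eq_preserves ji pid.
pose W := (U `&` cdom c) `&` p @^-1` cdom d.
apply: (@open_eq_near _ _ (cmap c @` W)).
- by apply: rep_dom_open => // z _; exact: hp.1.1.
- move=> v; rewrite inE => -[z [[Uz cz] dz] <-].
  by rewrite /rep /= (chart_invK (hX.1 _ Xc))// (chart_invK (hY.1 _ Yd))// gK.
- by exists x.
Qed.

End inverse.

(** Locally [f] is [f \o p] composed with an affine local inverse of [p]. *)
Lemma affine_descent m n q (Z : conn_mfd R m) (X : conn_mfd R n) (Y : conn_mfd R q)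
    (p : Z -> X) (f : X -> Y) :
  good_atlas Z -> good_atlas X -> good_atlas Y ->
  affine_map p -> local_diffeo p -> range p = setT ->
  affine_map (f \o p) -> affine_map f.
Proof.
move=> hZ hX hY hp [_ lp] sp hfp; apply/affine_mapE/affine_on_local => x _.
have [z _ <-] : range p x by rewrite sp.
have [U [g [oU Uz opU sg gK]]] := lp z.
exists (p @` U); first by exists z.
have hg := affine_local_inverse hZ hX hp oU opU sg gK.
have := affine_on_comp hX hZ hY opU openT (fun _ _ => I) hg ((affine_mapE _).1 hfp).
by apply: affine_on_eq => // y; rewrite inE => -[t Ut <-] /=; rewrite gK.
Qed.

Lemma affine_inverse m n (X : conn_mfd R m) (Y : conn_mfd R n) (p : X -> Y) (q : Y -> X) :
  good_atlas X -> good_atlas Y -> affine_map p -> local_diffeo p ->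
  cancel p q -> cancel q p -> affine_map q.
Proof.
move=> hX hY hp [_ lp] pK qK; apply/affine_mapE/affine_on_local => y _.
have [U [g [oU Uz opU sg gK]]] := lp (q y).
exists (p @` U); first by exists (q y).
apply: (affine_on_eq hY hX opU (f := g)); last exact: (affine_local_inverse hX hY hp oU).
by move=> t; rewrite inE => -[x Ux <-]; rewrite gK// pK.
Qed.

Lemma affine_comp m n q (X : conn_mfd R m) (Y : conn_mfd R n) (Z : conn_mfd R q)
    (f : X -> Y) (g : Y -> Z) :
  good_atlas X -> good_atlas Y -> good_atlas Z ->
  affine_map f -> affine_map g -> affine_map (g \o f).
Proof.
move=> hX hY hZ /affine_mapE hf /affine_mapE hg; apply/affine_mapE.
exact: (affine_on_comp hX hY hZ openT openT).
Qed.

End manifolds.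

(** * Affine maps of R^n *)

Section flat.
Context {R : realType}.

(** The mean value theorem, applied to each coordinate along the segment from [x] to [y], which
    stays in the ball. *)
Lemma zero_diff_constant m n (F : 'cV[R]_m -> 'cV[R]_n) (x y : 'cV[R]_m) (r : R) :
  (forall z, ball x r z -> is_diff z F (fun _ => 0)) -> ball x r y -> F y = F x.
Proof.
move=> dF xy.
pose seg (t : R) := x + t *: (y - x).
have segP (t : R) : t \in `[0, 1]%R -> ball x r (seg t).
  rewrite in_itv /= => /andP[t0 t1].
  move: xy; rewrite -ball_normE /= /seg opprD addNKr normrN normrZ ger0_norm//.
  rewrite distrC; apply: le_lt_trans; rewrite -[leRHS]mul1r.
  by rewrite ler_wpM2r.
have dseg (t : R) : is_diff t seg (fun s => s *: (y - x)).
  apply: is_diff_eq (is_diffD (is_diff_cst x t) (is_diff_scalel t (y - x))) _.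
  by apply/funext => s; rewrite fctE add0r.
have dphi i (t : R) : t \in `[0, 1]%R -> is_diff t (fun s => F (seg s) i 0 : R) (fun _ => 0).
  move=> /segP/dF dFt; have := is_diff_coord i (is_diff_comp (dseg t) dFt).
  by move=> H; apply: is_diff_eq H _; apply/funext => s /=; rewrite mxE.
apply/matrixP => i j; rewrite (ord1 j).
have : F (seg 1) i 0 - F (seg 0) i 0 = 0.
  have [| |c _ ->] := @MVT_segment R (fun s => F (seg s) i 0) (fun _ => 0) 0 1 ler01.
  - move=> t t01; have /dphi-/(_ i) dt : t \in `[0, 1]%R by apply: subset_itv_oo_cc.
    split; first by apply/derivable1_diffP; case: dt.
    have df : differentiable (fun s => F (seg s) i 0 : R) t by case: dt.
    exact: etrans (deriveE (1 : R) df) (is_diffE (1 : R) dt).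
  - apply: continuous_in_subspaceT => t; rewrite inE => t01;
    by apply: differentiable_continuous; have [] := dphi i t t01.
  - by rewrite mul0r.
by rewrite /seg scale1r scale0r addr0 subrKC => /subr0_eq.
Qed.

(** With zero Christoffel symbols the condition says that the second derivative vanishes. Hence
    ['d F] is constant on a ball around [x], and so is the difference of [F] and ['d F x]. *)
Lemma flat_local_affine n (A : set 'cV[R]_n) (F : 'cV[R]_n -> 'cV[R]_n) x :
  open A -> A x -> Ck 2 A F ->
  (forall y, A y -> preserves_conn (fun _ _ _ _ => 0) (fun _ _ _ _ => 0) F y) ->
  exists k : aff R n, \forall y \near x, F y = app k y.
Proof.
move=> oA Ax [dF ddF] pF.
have [r r0 xrA] : exists2 r : R, 0 < r & ball x r `<=` A.
  have /nbhs_ballP[r /= r0 xr] : nbhs x A by apply: open_nbhs_nbhs; split.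
  by exists r.
have d2F v y : A y -> is_diff y (fun y => 'd F y v) (fun _ => 0).
  move=> Ay; have dd := differentiableP ((ddF v).1 y Ay).
  apply: is_diff_eq dd _; apply/funext => u.
  have := pF y Ay u v; rewrite !christoffel0 addr0 => <-.
  exact: linear0.
have dFc v y : ball x r y -> 'd F y v = 'd F x v.
  exact: (zero_diff_constant (F := fun y => 'd F y v) (fun z hz => d2F v z (xrA _ hz))).
pose L : 'M[R]_n := \matrix_(i, j) ('d F x (delta_mx j 0)) i 0.
have LE v : L *m v = 'd F x v.
  apply: etrans (esym (linear_col_sum ('d F x) v)); apply/matrixP => i j.
  rewrite (ord1 j) !mxE summxE; apply: eq_bigr => a _.
  by rewrite !mxE mulrC.
exists (Aff L (F x - L *m x)).
have : \forall y \near x, ball x r y by exact: nbhsx_ballx.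
apply: filterS => y xy; rewrite /app /=.
pose G := F \- 'd F x.
have dG z : ball x r z -> is_diff z G (fun _ => 0).
  move=> xz; have cL : continuous ('d F x) by apply: diff_continuous; exact: dF.
  have dL : is_diff z ('d F x) ('d F x).
    by split; [exact: linear_differentiable|exact: diff_lin].
  apply: is_diff_eq (is_diffB (differentiableP (dF z (xrA _ xz))) dL) _.
  apply/funext => u; apply: etrans (_ : 'd F z u - 'd F x u = 0) => //.
  by apply/eqP; rewrite subr_eq0; apply/eqP; exact: dFc.
have Gxy : G y = G x := zero_diff_constant dG xy.
have -> : F y = G y + 'd F x y by rewrite /G /= subrK.
by rewrite Gxy /G /= !LE addrC.
Qed.

End flat.

(** * Lifting affine maps through affine local diffeomorphisms *)

Section affine_lift.
Context {R : realType}.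

Lemma Rn_good n : good_atlas (Rn R n).
Proof.
split=> [c -> /=|x]; last by exists (Chart setT id id).
split.
- exact: openT.
- rewrite /cran /= image_id; exact: openT.
- by [].
- by move=> x _; exact: cvg_id.
- by move=> x _; exact: cvg_id.
Qed.

Lemma Ck_id n k : Ck k [set: 'cV[R]_n] (id : 'cV[R]_n -> 'cV[R]_n).
Proof.
case: k => [|k]; first by move=> x _; exact: cvg_id.
have dI (x : 'cV[R]_n) : is_diff x id (fun v => v) by exact: is_diff_id.
exact: (CkS_intro openT (fun x _ => dI x) (fun v => Ck_cst k v openT)).
Qed.

Lemma Ck_app n k (h : aff R n) : Ck k setT (app h).
Proof.
have -> : app h = fun x => \sum_j x j 0 *: col j (lin h) + trans h.
  apply/funext => x; rewrite /app; congr (_ + _).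
  apply/matrixP => i j; rewrite (ord1 j) !mxE summxE.
  by apply: eq_bigr => a _; rewrite !mxE mulrC.
apply: CkD; [exact: openT| |exact: Ck_cst openT].
apply: Ck_sum => [|j]; first exact: openT.
apply: CkZ; [exact: openT| |exact: Ck_cst openT].
by apply: Ck_coord; [exact: openT|exact: Ck_id].
Qed.

Lemma app_continuous n (h : aff R n) : continuous (app h).
Proof. by move=> x; exact: (@Ck_app n 0 h x I). Qed.

Lemma jet2_app n (h : aff R n) x :
  jet2 (app h) x (fun v => lin h *m v) (fun _ _ => 0).
Proof.
have [dh _] := Ck_app 2 h.
have dlin y : is_diff y (app h) (fun v => lin h *m v).
  have cL : continuous (mulmx (lin h) : 'cV[R]_n -> 'cV[R]_n).
    have -> : (mulmx (lin h) : 'cV[R]_n -> 'cV[R]_n) = app (Aff (lin h) 0).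
      by apply/funext => z; rewrite /app /= addr0.
    exact: app_continuous.
  have dL : is_diff y (mulmx (lin h) : 'cV[R]_n -> 'cV[R]_n) (mulmx (lin h)).
    split; first exact: (@linear_differentiable _ _ _ (mulmx (lin h))).
    exact: (@diff_lin _ _ _ (mulmx (lin h))).
  apply: is_diff_eq (is_diffD dL (is_diff_cst (trans h) y)) _.
  by apply/funext => v; rewrite fctE addr0.
split=> [||v]; [by near=> y; exact: dh|exact: dlin|].
have d0 : is_diff x (cst (lin h *m v)) (0 : 'cV[R]_n -> 'cV[R]_n).
  exact: is_diff_cst.
apply: near_eq_is_diff d0.
by near=> y; exact/esym/(is_diffE v (dlin y)).
Unshelve. all: by end_near. Qed.

Lemma affine_app n (h : aff R n) : affine_map (app h : Rn R n -> Rn R n).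
Proof.
split; first split.
- by move=> x _; exact: app_continuous.
- by move=> c c' -> -> k; apply: Ck_sub (Ck_app k h).
move=> c c' x -> -> _ _.
apply/(preserves_connP _ _ (jet2_app h x)) => u v.
by rewrite !christoffel0 mulmx0 addr0.
Qed.

Lemma affine_on_Rn n (A : set (Rn R n)) (F : Rn R n -> Rn R n) x :
  open A -> affine_on A F -> A x ->
  exists k : aff R n, \forall y \near x, F y = app k y.
Proof.
move=> oA [[_ sF] pF] Ax.
apply: (@flat_local_affine R n A F x oA Ax).
  apply: Ck_sub (sF (Chart setT id id) (Chart setT id id) erefl erefl 2%N).
  by move=> y Ay; exists y.
move=> y Ay.
exact: (pF (Chart setT id id) (Chart setT id id) y Ay erefl erefl I I).
Qed.

Lemma app_sub_line n (h h' : aff R n) (x y : 'cV[R]_n) (t : R) :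
  app h x = app h' x ->
  app h (x + t *: (y - x)) - app h' (x + t *: (y - x)) =
  t *: (app h y - app h' y).
Proof.
move=> /eqP; rewrite -subr_eq0; pose M := lin h - lin h'.
have D z : app h z - app h' z = M *m z + (trans h - trans h').
  by rewrite /app mulmxBl opprD addrACA.
rewrite !D addr_eq0 => /eqP e; have -> : trans h - trans h' = - (M *m x).
  by rewrite e opprK.
by rewrite mulmxDr -scalemxAr mulmxBr addrAC subrr add0r.
Qed.

(** The difference of the two maps vanishes at [x], so it is homogeneous along the line from [x] to
    [y]; a small nonzero parameter [t] reaches the neighbourhood, and dividing by [t] gives equality
    at [y]. *)
Lemma near_eq_app n (h h' : aff R n) (x : 'cV[R]_n) :
  (\forall y \near x, app h y = app h' y) -> forall y, app h y = app h' y.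
Proof.
move=> hh' y.
have cl : {for (0 : R), continuous (fun t : R => x + t *: (y - x))}.
  apply: continuousD; first exact: cst_continuous.
  by apply: continuousZr_tmp; exact: cvg_id.
have nt : \forall t \near (0 : R), app h (x + t *: (y - x)) = app h' (x + t *: (y - x)).
  apply: (cl [set z | app h z = app h' z]).
  by rewrite scale0r addr0; exact: hh'.
have [t [t0 ht]] : exists t : R, t != 0 /\
    app h (x + t *: (y - x)) = app h' (x + t *: (y - x)).
  have : \forall t \near (0 : R)^', app h (x + t *: (y - x)) = app h' (x + t *: (y - x)).
    exact: nbhs_dnbhs.
  move=> nt'; have : \forall t \near (0 : R)^', t != 0 by exact: nbhs_dnbhs_neq.
  by move=> /(filterI nt') /filter_ex[t [? ?]]; exists t.
have := app_sub_line y t (nbhs_singleton hh').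
rewrite ht subrr => /esym/eqP; rewrite scaler_eq0 (negPf t0)/= subr_eq0.
by move/eqP.
Qed.

(** The space is a union of continuous images of the real line that all contain the origin. *)
Lemma connected_cV n : connected [set: 'cV[R]_n].
Proof.
have -> : [set: 'cV[R]_n] = \bigcup_(w in [set: 'cV[R]_n]) range (fun t : R => t *: w).
  by apply/seteqP; split=> // w _; exists w => //; exists 1 => //; rewrite scale1r.
apply: bigcup_connected.
  by exists 0 => w _; exists 0 => //; rewrite scale0r.
move=> w _; apply: connected_continuous_connected.
  by apply/connected_intervalP.
by apply: continuous_subspaceT => t; apply: continuousZr_tmp; exact: cvg_id.
Qed.

Lemma closure_equalizer (S T : topologicalType) (f g : S -> T) x :
  hausdorff_space T -> continuous f -> continuous g ->
  closure [set y | f y = g y] x -> f x = g x.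
Proof.
move=> hT cf cg clx; apply: hT => A B fA gB.
have nA : nbhs x (f @^-1` A) by exact: cf.
have nB : nbhs x (g @^-1` B) by exact: cg.
have [y [/= fg [Ay By]]] := clx _ (filterI nA nB).
by exists (f y); split=> //; rewrite fg.
Qed.

Section lift.
Context {n : nat} {X : conn_mfd R n}.
Hypotheses (hX : good_atlas X) (hausX : hausdorff_space X).
Variables (p pi : Rn R n -> X).
Hypotheses (hp : affine_map p) (lp : local_diffeo p) (hpi : affine_map pi).

(** Composing [pi] with the local inverse of [p] around [w] gives an affine map between open sets of
    R^n, which near [v] is given by some [aff]. *)
Lemma local_affine_lift v w : p w = pi v ->
  exists2 k : aff R n, app k v = w & \forall y \near v, p (app k y) = pi y.
Proof.
move=> pw; have [U [g [oU Uw opU sg gK]]] := lp.2 w.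
have hg := affine_local_inverse (Rn_good n) hX hp oU opU sg gK.
have oA : open (setT `&` pi @^-1` (p @` U)).
  by apply: openI_preimage => //; [exact: openT|move=> y _; exact: hpi.1.1].
have hF : affine_on (setT `&` pi @^-1` (p @` U)) (g \o pi).
  apply: (affine_on_comp (Rn_good n) hX (Rn_good n) oA opU _ _ hg).
    by move=> y [].
  exact: affine_on_sub ((affine_mapE _).1 hpi).
have Av : (setT `&` pi @^-1` (p @` U)) v by split=> //; exists w.
have [k Fk] := affine_on_Rn oA hF Av.
exists k; first by rewrite -(nbhs_singleton Fk) /= -pw gK.
have nA : \forall y \near v, (setT `&` pi @^-1` (p @` U)) y.
  by apply: open_nbhs_nbhs; split.
by apply: filterS2 Fk nA => y <- [_ [z Uz /= <-]]; rewrite gK.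
Qed.

(* The set where [p o k = pi] near [x] is closed: at a limit point [x] one has
   [p (k x) = pi x], so [pi] has a local affine lift through [k x], which
   coincides with [k] on an open set, hence everywhere. *)
Lemma affine_lift v w : p w = pi v ->
  exists2 k : aff R n, app k v = w & forall y, p (app k y) = pi y.
Proof.
move=> pw; have [k kv nk] := local_affine_lift pw; exists k => //.
pose S := [set x : 'cV[R]_n | \forall y \near x, p (app k y) = pi y].
have cpk : continuous (p \o app k).
  by move=> x; apply: continuous_comp; [exact: app_continuous|exact: hp.1.1].
have cpi : continuous pi by move=> x; exact: hpi.1.1.
suff ST : S = setT.
  by move=> y; have : S y by [rewrite ST]; exact: nbhs_singleton.
apply: connected_cV.
- by exists v.
- exists S; last by rewrite setTI.
  by rewrite openE => x; exact: near_join.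
- exists S; last by rewrite setTI.
  move=> x clx.
  have px : p (app k x) = pi x.
    apply: (closure_equalizer hausX cpk cpi); apply: closureS clx => y.
    by move=> /nbhs_singleton.
  have [k1 k1x nk1] := local_affine_lift px.
  have [U [g [oU Ux _ _ gK]]] := lp.2 (app k x).
  have nU : \forall y \near x, U (app k y).
    by apply: app_continuous; apply: open_nbhs_nbhs; split.
  have nU1 : \forall y \near x, U (app k1 y).
    by apply: app_continuous; apply: open_nbhs_nbhs; split=> //; rewrite k1x.
  have nE : \forall y \near x, p (app k y) = pi y -> app k y = app k1 y.
    near=> y => e; rewrite -[LHS]gK; last by near: y.
    rewrite e -(near nk1 y)// gK//; near: y; exact: nU1.
  (* [nE] holds around every point close to [x], one of which lies in [S]; around that point [k] and
     [k1] agree. *)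
  have [y [Sy nEy]] := clx _ (near_join nE).
  have kk1 : forall z, app k z = app k1 z.
    by apply: (@near_eq_app _ _ _ y); apply: filterS2 Sy nEy => z e; exact.
  by apply: filterS nk1 => z; rewrite kk1.
Unshelve. all: by end_near. Qed.

End lift.
End affine_lift.

(** * Descent along affine local diffeomorphisms *)

Section affine_group.
Context {R : realType} {n : nat}.
Implicit Types k h : aff R n.

Definition aff_comp k h := Aff (lin k *m lin h) (lin k *m trans h + trans k).
Definition aff_inv k := Aff (invmx (lin k)) (- (invmx (lin k) *m trans k)).

Lemma app_comp k h v : app (aff_comp k h) v = app k (app h v).
Proof. by rewrite /app /= mulmxDr mulmxA addrA. Qed.

Lemma appK k : is_aut k -> cancel (app k) (app (aff_inv k)).
Proof. by move=> uk v; rewrite /app /= mulmxDr mulmxA mulVmx// mul1mx addrK. Qed.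

Lemma appVK k : is_aut k -> cancel (app (aff_inv k)) (app k).
Proof.
by move=> uk v; rewrite /app /= mulmxBr mulmxA mulmxV// mul1mx mulmxA mulmxV//
  mul1mx subrK.
Qed.

Lemma is_aut_inv k : is_aut k -> is_aut (aff_inv k).
Proof. by rewrite /is_aut /= unitmx_inv. Qed.

Lemma is_aut_comp k h : is_aut k -> is_aut h -> is_aut (aff_comp k h).
Proof. by rewrite /is_aut /= unitmx_mul => -> ->. Qed.

Lemma app_inj k h : (forall v, app k v = app h v) -> k = h.
Proof.
case: k h => [L t] [L' t']; rewrite /app /= => e.
have tt : t = t' by have := e 0; rewrite !mulmx0 !add0r.
have LL : L = L'.
  apply/matrixP => i j; have := e (delta_mx j 0); rewrite tt => /addIr.
  by rewrite -!colE => /matrixP/(_ i 0); rewrite !mxE.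
by rewrite tt LL.
Qed.

Lemma app_conj k h v : is_aut k -> app (aff_conj k h) (app k v) = app k (app h v).
Proof.
move=> uk; rewrite /app /= !mulmxDr -[LHS]addrA subrKC addrA; congr (_ + _ + _).
by rewrite !mulmxA mulmxKV.
Qed.

Lemma eq_aff_conj k h h' : is_aut k ->
  (forall v, app h' (app k v) = app k (app h v)) -> h' = aff_conj k h.
Proof.
by move=> uk e; apply: app_inj => v; rewrite -(appVK uk v) e app_conj.
Qed.

Lemma mulmx_cV_eq0 m (A : 'M[R]_(m, n)) : (forall u : 'cV[R]_n, A *m u = 0) -> A = 0.
Proof.
move=> A0; apply/matrixP => i j; have := A0 (delta_mx j 0).
by rewrite -colE => /matrixP/(_ i 0); rewrite !mxE.
Qed.

(** [kermx] consists of row vectors, hence the passage to the transpose. *)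
Lemma unitmx_ker (A : 'M[R]_n) :
  (forall u : 'cV[R]_n, A *m u = 0 -> u = 0) -> A \in unitmx.
Proof.
move=> kA; rewrite -unitmx_tr -row_free_unit -kermx_eq0; apply/eqP/row_matrixP => i.
rewrite row0; apply: trmx_inj; rewrite trmx0; apply: kA.
apply: trmx_inj; rewrite trmx_mul trmxK trmx0.
by rewrite -row_mul mulmx_ker row0.
Qed.

End affine_group.

Section descend.
Context {R : realType}.

Lemma local_diffeo_inj m n (X : charted R m) (Y : charted R n) (p : X -> Y) x :
  local_diffeo p -> exists U : set X,
    [/\ open U, U x & forall y z, U y -> U z -> p y = p z -> y = z].
Proof.
move=> [_ /(_ x)[U [g [oU Ux _ _ gK]]]]; exists U; split=> // y z Uy Uz e.
by rewrite -[y]gK// e gK.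
Qed.

(** A small nonzero [t] keeps [x + t *: u] where [p] is injective, which forces [t *: u] to
    vanish. *)
Lemma constant_on_line_eq0 m n (Y : charted R n) (p : Rn R m -> Y) (x u : 'cV[R]_m) :
  local_diffeo p -> (forall t : R, p (x + t *: u) = p x) -> u = 0.
Proof.
move=> lp pc; have [U [oU Ux injU]] := local_diffeo_inj (x : Rn R m) lp.
have cl : {for (0 : R), continuous (fun t : R => x + t *: u)}.
  apply: continuousD; first exact: cst_continuous.
  by apply: continuousZr_tmp; exact: cvg_id.
have nt : \forall t \near (0 : R), U (x + t *: u).
  apply: (cl U); rewrite scale0r addr0.
  by apply: open_nbhs_nbhs; split.
have nt' : \forall t \near (0 : R)^', U (x + t *: u) by exact: nbhs_dnbhs.
have n0 : \forall t \near (0 : R)^', t != 0 by exact: nbhs_dnbhs_neq.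
have [t [Ut t0]] := filter_ex (filterI nt' n0).
have /eqP := injU _ _ Ut Ux (pc t).
by rewrite -subr_eq0 addrC addKr scaler_eq0 (negPf t0)/= => /eqP.
Qed.

(** A vector killed by [lin k] spans a line on which [Phi \o pi], hence [pi], is constant. *)
Lemma lift_is_aut n (X Y : conn_mfd R n) (pi : Rn R n -> X) (p : Rn R n -> Y)
    (Phi : X -> Y) (k : aff R n) :
  local_diffeo pi -> injective Phi ->
  (forall v, p (app k v) = Phi (pi v)) -> is_aut k.
Proof.
move=> lpi iPhi pk; apply: unitmx_ker => u ku.
apply: (constant_on_line_eq0 (x := 0) lpi) => t; apply: iPhi.
by rewrite -!pk add0r /app -scalemxAr ku scaler0 mulmx0.
Qed.

(** Both maps are defined through chosen preimages; the two directions of the last hypothesis make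
    [Phi] and its inverse independent of the choice, and both are affine by descent. *)
Lemma descend_isom n (X Y : conn_mfd R n) (p : Rn R n -> X) (q : Rn R n -> Y)
    (k : aff R n) :
  good_atlas X -> good_atlas Y -> is_aut k ->
  affine_map p -> local_diffeo p -> range p = setT ->
  affine_map q -> local_diffeo q -> range q = setT ->
  (forall v w, p v = p w <-> q (app k v) = q (app k w)) ->
  exists2 Phi : X -> Y, affine_isom Phi & forall v, Phi (p v) = q (app k v).
Proof.
move=> hX hY uk hp lp sp hq lq sq pq.
have psurj x : exists v, p v = x by have [v _] : range p x by [rewrite sp]; exists v.
have qsurj x : exists v, q v = x by have [v _] : range q x by [rewrite sq]; exists v.
have [a aP] := choice psurj; have [b bP] := choice qsurj.
pose Phi x := q (app k (a x)); pose Psi y := p (app (aff_inv k) (b y)).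
have PhiE v : Phi (p v) = q (app k v) by apply/pq; rewrite aP.
have PsiE v : Psi (q v) = p (app (aff_inv k) v) by apply/pq; rewrite !appVK// bP.
exists Phi => //; exists Psi; split.
- by move=> x; rewrite -(aP x) PhiE PsiE appK.
- by move=> y; rewrite -(bP y) PsiE PhiE appVK.
- apply: (affine_descent (Rn_good n) hX hY hp lp sp).
  have -> : Phi \o p = q \o app k by apply/funext => v; exact: PhiE.
  exact: affine_comp (Rn_good n) (Rn_good n) hY (affine_app k) hq.
- apply: (affine_descent (Rn_good n) hY hX hq lq sq).
  have -> : Psi \o q = p \o app (aff_inv k) by apply/funext => v; exact: PsiE.
  exact: affine_comp (Rn_good n) (Rn_good n) hX (affine_app (aff_inv k)) hp.
Qed.

Lemma bundle_isom_over m n (X Y : conn_mfd R n) (B B' : conn_mfd R m)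
    (f : X -> B) (f' : Y -> B') (Phi : X -> Y) (beta : B -> B') :
  affine_isom Phi -> injective beta -> (forall x, f' (Phi x) = beta (f x)) ->
  bundle_isom f f' Phi.
Proof.
move=> iPhi ibeta fPhi; split=> // b; exists (beta b).
have [Psi [_ PsiK _ _]] := iPhi.
apply/seteqP; split=> [_ [x /= <- <-]|y /= fy]; first exact: fPhi.
by exists (Psi y) => //=; apply: ibeta; rewrite -fPhi PsiK.
Qed.

End descend.

(** * The inverse developing map followed by the covering projection *)

Section development.
Context {R : realType} {n : nat} {M : conn_mfd R n} {U : development M}.
Hypotheses (hM : good_atlas M) (hU : is_development U).
Variable e : Rn R n -> U.
Hypotheses (devK : cancel (@dev R n M U) e) (eK : cancel e (@dev R n M U)).

Let hUa : good_atlas U := affine_manifold_good (ucov_affine hU).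

Lemma dev_inv_affine : affine_map e.
Proof.
by apply: (affine_inverse hUa (Rn_good n) (dev_affine hU) (dev_local_diffeo hU)).
Qed.

Lemma dev_inv_continuous : continuous e.
Proof. by move=> x; exact: dev_inv_affine.1.1. Qed.

Lemma uproj_dev_affine : affine_map (uproj \o e).
Proof. exact: affine_comp (Rn_good n) hUa hM dev_inv_affine (uproj_affine hU). Qed.

Lemma uproj_dev_local_diffeo : local_diffeo (uproj \o e).
Proof.
split=> [|v]; first exact: uproj_dev_affine.1.
have [V [g [oV Vev opV sg gK]]] := (uproj_local_diffeo hU).2 (e v).
have hg := affine_local_inverse hUa hM (uproj_affine hU) oV opV sg gK.
have imE : (uproj \o e) @` (e @^-1` V) = uproj @` V.
  apply/seteqP; split=> [_ [w Vw <-]|_ [x Vx <-]]; first by exists (e w).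
  by exists (dev x); rewrite /= ?devK.
have hdev : affine_on setT (@dev R n M U) by apply/affine_mapE/dev_affine.
have [sdg _] := affine_on_comp hM hUa (Rn_good n) opV openT (fun _ _ => I) hg hdev.
exists (e @^-1` V), (dev \o g); split.
- have := openI_preimage openT oV (fun x _ => @dev_inv_continuous x).
  by rewrite setTI.
- exact: Vev.
- by rewrite imE.
- by rewrite imE.
- by move=> y Vy /=; rewrite gK// eK.
Qed.

(** An evenly covered open set has at least one sheet, whose section gives a preimage. *)
Lemma uproj_dev_surj : range (uproj \o e) = setT.
Proof.
rewrite -subTset => y _.
have [_ /(_ y)[W [_ Wy [I [V [s [[i] _ _ /(_ i)[_ _ sP _]]]]]]]] := uproj_covering hU.
have [_ psy] := sP _ Wy.
by exists (dev (s i y)); rewrite /= ?devK.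
Qed.

End development.

(** * Developing the base and the total spaces *)

Section base.
Context {R : realType} {m l : nat} {B : conn_mfd R m} {UB : development B}.
Context {P PB : groupType} {rhoB : PB -> UB -> UB} {pr : P -> PB}.
Context {M : conn_mfd R (m + l)} {F : charted R l} {f : M -> B}.
Context {U : development M} {tf : U -> UB} {rho : P -> U -> U}.
Context {h : P -> aff R (m + l)} {E : conn_mfd R (m + l)}.
Context {q : Rn R (m + l) -> E} {fh : E -> Rn R m}.
Hypothesis hUB : is_development UB.
Hypothesis hf : bundle_setting rhoB pr F f tf rho h q fh.

Lemma total_dev_inverse : exists e : Rn R (m + l) -> U,
  cancel (@dev R (m + l) M U) e /\ cancel e (@dev R (m + l) M U).
Proof. by have [e [devK eK _ _]] := bs_complete hf; exists e. Qed.

(* [s x = tf (e (x, 0))] is a section of [dev]; its image is open because [dev]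
   is locally injective, and closed because [UB] is Hausdorff. *)
Lemma base_dev_inverse : exists s : Rn R m -> UB,
  cancel (@dev R m B UB) s /\ cancel s (@dev R m B UB).
Proof.
have [e [devK eK]] := total_dev_inverse.
have hU := bs_development hf.
have ce := dev_inv_continuous hU devK eK.
pose j (x : Rn R m) : Rn R (m + l) := col_mx x 0.
have cj : continuous j.
  pose L : 'M[R]_(m + l, m) := col_mx 1%:M 0.
  have -> : j = fun x : 'cV[R]_m => \sum_i x i 0 *: col i L.
    apply/funext => x; have -> : j x = L *m x.
      by rewrite /j /L mul_col_mx mul1mx mul0mx.
    apply/matrixP => a b; rewrite (ord1 b) !mxE summxE.
    by apply: eq_bigr => c _; rewrite !mxE mulrC.
  have C0 : Ck 0 [set: 'cV[R]_m] (fun x : 'cV[R]_m => \sum_i x i 0 *: col i L).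
    apply: Ck_sum => [|i]; first exact: openT.
    apply: CkZ; [exact: openT| |exact: Ck_cst openT].
    by apply: Ck_coord; [exact: openT|exact: Ck_id].
  by move=> x; exact: C0.
pose s x := tf (e (j x)).
have sK : cancel s (@dev R m B UB).
  by move=> x; rewrite /s (bs_adapted hf) eK /j col_mxKu.
have cs : continuous s.
  move=> x; apply: continuous_comp; last exact: (bs_lift_cont hf).
  by apply: continuous_comp; [exact: cj|exact: ce].
have cdev : continuous (@dev R m B UB) by move=> x; exact: (dev_affine hUB).1.1.
have csd : continuous (s \o @dev R m B UB).
  by move=> x; apply: continuous_comp; [exact: cdev|exact: cs].
pose W := [set x : UB | (s \o @dev R m B UB) x = x].
suff WT : W = setT by exists s; split=> // x; have : W x by rewrite WT.
have hB := am_smooth (ucov_affine hUB).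
apply: (am_connected (ucov_affine hUB)).
- by exists (s 0); rewrite /W /= sK.
- exists W; last by rewrite setTI.
  rewrite openE => x Wx.
  have [V [oV Vx injV]] := local_diffeo_inj x (dev_local_diffeo hUB).
  have nV : \forall y \near x, V y by apply: open_nbhs_nbhs; split.
  have nsV : \forall y \near x, V (s (dev y)).
    by apply: (csd x V); rewrite Wx; apply: open_nbhs_nbhs; split.
  by apply: filterS2 nV nsV => y Vy sVy; apply: injV => //; rewrite sK.
- exists W; last by rewrite setTI.
  move=> x; apply: (closure_equalizer (sm_hausdorff hB) csd).
  by move=> y; exact: cvg_id.
Qed.

End base.

(** Presents [M] as the quotient of R^(m+l) by the holonomy group, without its universal cover.
    [un_deck] identifies the affine automorphisms over the identity of [M]; [un_base] and [un_pr]
    describe the position over the developed base. *)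
Record uniformized (R : realType) (m l : nat) (B : conn_mfd R m)
    (UB : development B) (s : Rn R m -> UB) (P PB : groupType)
    (rhoB : PB -> UB -> UB) (pr : P -> PB) (M : conn_mfd R (m + l)) (f : M -> B)
    (h : P -> aff R (m + l)) (p : Rn R (m + l) -> M) : Prop := Uniformized {
  un_good : good_atlas M;
  un_haus : hausdorff_space M;
  un_affine : affine_map p;
  un_local_diffeo : local_diffeo p;
  un_surj : range p = setT;
  un_aut : forall g, is_aut (h g);
  un_orbit : forall v w, p v = p w <-> exists g, w = app (h g) v;
  un_deck : forall k, is_aut k -> (forall v, p (app k v) = p v) ->
    exists g, forall v, app (h g) v = app k v;
  un_inj : forall g g', (forall v, app (h g) v = app (h g') v) -> g = g';
  un_mul : forall g g' v, app (h (g * g')%g) v = app (h g) (app (h g') v);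
  un_base : forall v : 'cV[R]_(m + l), f (p v) = uproj (s (usubmx v));
  un_pr : forall g (v : 'cV[R]_(m + l)),
    usubmx (app (h g) v) = dev (rhoB (pr g) (s (usubmx v))) }.

Section total.
Context {R : realType} {m l : nat} {B : conn_mfd R m} {UB : development B}.
Context {P PB : groupType} {rhoB : PB -> UB -> UB} {pr : P -> PB}.
Context {M : conn_mfd R (m + l)} {F : charted R l} {f : M -> B}.
Context {U : development M} {tf : U -> UB} {rho : P -> U -> U}.
Context {h : P -> aff R (m + l)} {E : conn_mfd R (m + l)}.
Context {q : Rn R (m + l) -> E} {fh : E -> Rn R m} {s : Rn R m -> UB}.
Hypothesis devKB : cancel (@dev R m B UB) s.
Hypothesis hf : bundle_setting rhoB pr F f tf rho h q fh.

(** The point is transitivity on the fibres of [p]: if [p v = p w], lifting [p] through itself from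
    [v] to [w] gives an affine automorphism over the identity, that is, a deck transformation. *)
Lemma bundle_uniformized : exists p : Rn R (m + l) -> M,
  uniformized s rhoB pr f h p.
Proof.
have [e [devK eK]] := total_dev_inverse hf.
have hU := bs_development hf; have hM := affine_manifold_good (ab_total (bs_bundle hf)).
have ha := uproj_dev_affine hM hU devK eK.
have hl := uproj_dev_local_diffeo hM hU devK eK.
have haus := sm_hausdorff (am_smooth (ab_total (bs_bundle hf))).
have ce := dev_inv_continuous hU devK eK.
have cdev : continuous (@dev R (m + l) M U) by move=> x; exact: (dev_affine hU).1.1.
have hol g v : e (app (h g) v) = rho g (e v).
  by have [_ H] := bs_holonomy hf g; rewrite -[RHS]devK H eK.
have aut g : is_aut (h g) by case: (bs_holonomy hf g).
have pinj := pi1_inj (bs_pi1 hf).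
have deckP k : is_aut k -> (forall v, uproj (e (app k v)) = uproj (e v)) ->
    exists g, forall v, app (h g) v = app k v.
  move=> uk pk; have : deck (U := U) (e \o app k \o dev).
    have cc k' : continuous (e \o app k' \o @dev R (m + l) M U).
      move=> x; apply: continuous_comp; first exact: cdev.
      by apply: continuous_comp; [exact: app_continuous|exact: ce].
    split; [exact: cc| |by move=> x; rewrite /= pk devK].
    exists (e \o app (aff_inv k) \o dev); split; last exact: cc.
      by move=> x; rewrite /= eK appK.
    by move=> x; rewrite /= eK appVK.
  have -> : deck (U := U) (e \o app k \o dev) =
            [set d | deck d] (e \o app k \o dev) by [].
  rewrite -(pi1_range (bs_pi1 hf)) => -[g _ gE]; exists g => v.
  by rewrite -[LHS]eK hol gE /= !eK.
have projh g v : uproj (e (app (h g) v)) = uproj (e v).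
  rewrite hol; have : deck (rho g) by have := pi1_range (bs_pi1 hf);
    move=> /seteqP[+ _] => /(_ (rho g)); apply; exists g.
  by case=> _ _ ->.
(* In developed coordinates [tf] is the projection of R^(m+l) onto R^m. *)
have tfE x : tf x = s (usubmx (dev x : 'cV[R]_(m + l))).
  by rewrite -(bs_adapted hf) devKB.
exists (uproj \o e); split=> //.
- exact: (uproj_dev_surj hU devK).
- move=> v w; split=> [pvw|[g ->]]; last by rewrite /= projh.
  have [k kv pk] := affine_lift hM haus ha hl ha (esym pvw).
  have uk : is_aut k by apply: (lift_is_aut (Phi := id) hl) => // x y.
  by have [g gE] := deckP k uk pk; exists g; rewrite gE.
- move=> g g' gg'; apply: pinj; apply/funext => x.
  by rewrite -(devK x) -!hol gg'.
- move=> g g' v; apply: (can_inj eK); rewrite !hol; exact: (pi1_mul (bs_pi1 hf)).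
- by move=> v; rewrite /= -(bs_lift hf) tfE eK.
- move=> g v; rewrite -[app (h g) v]eK -(bs_adapted hf) hol (bs_extension hf).
  by rewrite tfE eK.
Qed.

End total.

(** * Isomorphisms of bundles and their lifts *)

Section two_bundles.
Context {R : realType} {m l : nat} {B : conn_mfd R m} {UB : development B}.
Context {P PB : groupType} {rhoB : PB -> UB -> UB} {pr : P -> PB} {s : Rn R m -> UB}.
Hypotheses (hUB : is_development UB) (hB : good_atlas B) (hrhoB : is_pi1 rhoB).
Hypotheses (devK : cancel (@dev R m B UB) s) (sK : cancel s (@dev R m B UB)).
Let pB : Rn R m -> B := uproj \o s.

Lemma total_usub (z : 'cV[R]_m) : exists v : 'cV[R]_(m + l), usubmx v = z.
Proof. by exists (col_mx z 0); rewrite col_mxKu. Qed.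

(** [rhoB 1] is idempotent and, as a deck transformation, injective. *)
Lemma rhoB1 x : rhoB 1%g x = x.
Proof.
have : deck (rhoB 1%g).
  by have /seteqP[+ _] := pi1_range hrhoB => /(_ (rhoB 1%g)); apply; exists 1%g.
case=> _ [d [rK _ _]] _; apply: (can_inj rK).
by rewrite -(pi1_mul hrhoB) mulg1.
Qed.

Section one_direction.
Context {M1 M2 : conn_mfd R (m + l)} {f1 : M1 -> B} {f2 : M2 -> B}.
Context {h1 h2 : P -> aff R (m + l)}.
Context {p1 : Rn R (m + l) -> M1} {p2 : Rn R (m + l) -> M2}.
Hypotheses (u1 : uniformized s rhoB pr f1 h1 p1).
Hypotheses (u2 : uniformized s rhoB pr f2 h2 p2).
Context {Phi : M1 -> M2} {k : aff R (m + l)}.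
Hypotheses (pk : forall v, p2 (app k v) = Phi (p1 v)) (uk : is_aut k).

(** The conjugate of [h1 g] by [k] covers the identity of [M2], so it belongs to the holonomy group
    of [M2]. *)
Lemma lift_conj : injective Phi ->
  exists phi : P -> P, forall g v, app (h2 (phi g)) (app k v) = app k (app (h1 g) v).
Proof.
move=> iPhi; suff ex g : exists g', forall v,
    app (h2 g') (app k v) = app k (app (h1 g) v).
  by have [phi phiP] := choice ex; exists phi.
pose c := aff_comp (aff_comp k (h1 g)) (aff_inv k).
have [||g' g'P] := un_deck u2 (k := c).
- by rewrite !is_aut_comp ?is_aut_inv// (un_aut u1).
- move=> v; rewrite !app_comp pk.
  have -> : p1 (app (h1 g) (app (aff_inv k) v)) = p1 (app (aff_inv k) v).
    by apply/esym/(un_orbit u1); exists g.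
  by rewrite -pk appVK.
- by exists g' => v; rewrite g'P !app_comp appK.
Qed.

Lemma conj_cancel (phi phi' : P -> P) :
  (forall g v, app (h2 (phi g)) (app k v) = app k (app (h1 g) v)) ->
  (forall g v, app (h1 (phi' g)) (app (aff_inv k) v) = app (aff_inv k) (app (h2 g) v)) ->
  cancel phi phi' /\ cancel phi' phi.
Proof.
move=> e e'; split=> g.
  apply: (un_inj u1) => v.
  by rewrite -[v in LHS](appK uk) e' e appK.
apply: (un_inj u2) => v.
by rewrite -[v in LHS](appVK uk) e e' appVK.
Qed.

Lemma conj_morph (phi : P -> P) :
  (forall g v, app (h2 (phi g)) (app k v) = app k (app (h1 g) v)) ->
  {morph phi : x y / (x * y)%g}.
Proof.
move=> e g g'; apply: (un_inj u2) => v; rewrite -(appVK uk v) e.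
by rewrite (un_mul u1) (un_mul u2) !e.
Qed.

Hypothesis fibPhi : forall x y, f1 x = f1 y -> f2 (Phi x) = f2 (Phi y).

Lemma base_compat (v w : 'cV[R]_(m + l)) : pB (usubmx v) = pB (usubmx w) ->
  pB (usubmx (app k v)) = pB (usubmx (app k w)).
Proof.
move=> vw; have fvw : f1 (p1 v) = f1 (p1 w) by rewrite !(un_base u1).
by have := fibPhi fvw; rewrite -!pk !(un_base u2).
Qed.

(** A line in the fibre direction is sent by [k] to a line whose R^m component lies over a single
    point of [B]; since [pB] is a local diffeomorphism, that component is constant. *)
Lemma lift_ursubmx0 : ursubmx (lin k) = 0.
Proof.
have lpB := uproj_dev_local_diffeo hB hUB devK sK.
apply: mulmx_cV_eq0 => u.
apply: (constant_on_line_eq0 (x := usubmx (app k 0)) lpB) => t.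
have -> : usubmx (app k 0) + t *: (ursubmx (lin k) *m u) =
          usubmx (app k (col_mx 0 (t *: u))).
  rewrite /app mulmx0 add0r -{2}(submxK (lin k)) mul_block_col !mulmx0 add0r.
  rewrite addrC -scalemxAr; apply/matrixP => i j.
  by rewrite [RHS]mxE [RHS]mxE -[in RHS]/(lshift l i) col_mxEu !mxE.
by apply: base_compat; rewrite col_mxKu linear0.
Qed.

End one_direction.

Lemma lower_usub (k : aff R (m + l)) (v : 'cV[R]_(m + l)) : ursubmx (lin k) = 0 ->
  usubmx (app k v) = app (Aff (ulsubmx (lin k)) (usubmx (trans k))) (usubmx v).
Proof.
move=> k0; rewrite /app /= linearD /=; congr (_ + _).
rewrite -{1}(submxK (lin k)) -{1}(vsubmxK v) mul_block_col col_mxKu k0.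
by rewrite mul0mx addr0.
Qed.

Lemma lower_aut (k : aff R (m + l)) : ursubmx (lin k) = 0 -> is_aut k ->
  ulsubmx (lin k) \in unitmx.
Proof.
rewrite /is_aut !unitmxE => k0; rewrite -{1}(submxK (lin k)) k0 det_lblock.
by rewrite unitrM => /andP[].
Qed.

End two_bundles.

Theorem theorem5p1 (R : realType) (m l : nat)
  (* the common base and its universal cover *)
  (B : conn_mfd R m) (UB : development B) (PB : groupType)
  (rhoB : PB -> UB -> UB)
  (hUB : is_development UB) (hrhoB : is_pi1 rhoB)
  (* the common fundamental group, extension of pi_1(B) *)
  (P : groupType) (pr : P -> PB) (hpr : is_extension pr)
  (* the two affine bundles *)
  (M1 M2 : conn_mfd R (m + l)) (F1 F2 : charted R l)
  (f1 : M1 -> B) (f2 : M2 -> B)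
  (U1 : development M1) (U2 : development M2)
  (tf1 : U1 -> UB) (tf2 : U2 -> UB)
  (rho1 : P -> U1 -> U1) (rho2 : P -> U2 -> U2)
  (h1 h2 : P -> aff R (m + l))
  (E1 E2 : conn_mfd R (m + l))
  (q1 : Rn R (m + l) -> E1) (q2 : Rn R (m + l) -> E2)
  (fh1 : E1 -> Rn R m) (fh2 : E2 -> Rn R m)
  (hf1 : bundle_setting rhoB pr F1 f1 tf1 rho1 h1 q1 fh1)
  (hf2 : bundle_setting rhoB pr F2 f2 tf2 rho2 h2 q2 fh2)
  (hF : exists theta : F1 -> F2, diffeo theta)
  (hL : same_fibre_holonomy (piF pr) h1 h2) :
  (exists Phi : M1 -> M2, bundle_isom f1 f2 Phi)
  <->
  (exists (Psi : E1 -> E2) (k : aff R (m + l)) (k' : aff R m) (kB : UB -> UB)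
          (phi phi' : P -> P),
    (* k is a lift of the isomorphism Psi, over k', a lift of an automorphism
       of B *)
    [/\ bundle_isom fh1 fh2 Psi,
        is_aut k,
        forall v, q2 (app k v) = Psi (q1 v),
        forall v, usubmx (app k v) = app k' (usubmx v)
      & lifts_aut k' kB] /\
    (* phi is an automorphism of pi_1(M), with inverse phi' *)
    [/\ {morph phi : x y / (x * y)%g}, cancel phi phi' & cancel phi' phi] /\
    (* phi induces the conjugation by k' on pi_1(B), by k on pi_1(F) *)
    (forall g x, rhoB (pr (phi g)) (kB x) = kB (rhoB (pr g) x)) /\
    (forall g, piF pr g ->
       forall v, app (h2 (phi g)) (app k v) = app k (app (h1 g) v)) /\
    (* conditions on the linear holonomy, on [C] and on [D] *)
    [/\ forall g, lin (h2 (phi g)) = lin k *m lin (h1 g) *m invmx (lin k),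
        same_classC (fun g => Apart (h2 g)) (fun g => Bpart (h2 g))
          (fun g => Cpart (aff_conj k (h1 (phi' g)))) (fun g => Cpart (h2 g))
      & same_classD (fun g => Bpart (h2 g))
          (fun g => dpart (aff_conj k (h1 (phi' g)))) (fun g => dpart (h2 g))]).
Proof.
have hB : good_atlas B by exact: affine_manifold_good (ab_base (bs_bundle hf1)).
have [s [devK sK]] := base_dev_inverse hUB hf1.
have [p1 u1] := bundle_uniformized devK hf1.
have [p2 u2] := bundle_uniformized devK hf2.
have apB := uproj_dev_affine hB hUB devK sK.
have lpB := uproj_dev_local_diffeo hB hUB devK sK.
have spB := uproj_dev_surj hUB devK.
have cdev : continuous (@dev R m B UB) by move=> x; exact: (dev_affine hUB).1.1.
have cs := dev_inv_continuous hUB devK sK.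
(* By [un_pr] the R^m component of [h2 g] at a point depends only on the R^m component of that
   point. *)
have lower g : ursubmx (lin (h2 g)) = 0.
  apply: mulmx_cV_eq0 => u.
  have : usubmx (app (h2 g) (col_mx 0 u)) = usubmx (app (h2 g) 0).
    by rewrite !(un_pr u2) col_mxKu linear0.
  rewrite /app mulmx0 add0r linearD /= => /eqP; rewrite -subr_eq0 addrK.
  rewrite -{1}(submxK (lin (h2 g))) mul_block_col !mulmx0 !add0r col_mxKu.
  by move/eqP.
split.
  move=> [Phi [[G [PhiK GK aPhi aG]] fibPhi]].
  have iPhi := can_inj PhiK; have iG := can_inj GK.
  have fib x y : f1 x = f1 y -> f2 (Phi x) = f2 (Phi y).
    have [b' /seteqP[sub _]] := fibPhi (f1 y).
    have fb z : f1 z = f1 y -> f2 (Phi z) = b' by move=> e; apply: sub; exists z.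
    by move=> e; rewrite !fb.
  (* The image of the fibre through [G y] is the whole fibre through [y], so it contains [x]. *)
  have fib' x y : f2 x = f2 y -> f1 (G x) = f1 (G y).
    have [b' /seteqP[sub sup]] := fibPhi (f1 (G y)).
    have fy : f2 y = b' by apply: sub; exists (G y).
    by move=> e; have [z /= fz <-] := sup x (etrans e fy); rewrite PhiK.
  (* Any point over [Phi (p1 0)] can serve as the initial value of the lift of [Phi \o p1]. *)
  have [w0 _ w0P] : range p2 (Phi (p1 0)) by rewrite (un_surj u2).
  have [k _ pk] := affine_lift (un_good u2) (un_haus u2) (un_affine u2)
    (un_local_diffeo u2) (affine_comp (Rn_good _) (un_good u1) (un_good u2)
      (un_affine u1) aPhi) w0P.
  have {}pk v : p2 (app k v) = Phi (p1 v) := pk v.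
  have uk : is_aut k := lift_is_aut (un_local_diffeo u1) iPhi pk.
  have pk' v : p1 (app (aff_inv k) v) = G (p2 v).
    by apply: iPhi; rewrite GK -pk appVK.
  have [phi phiP] := lift_conj u1 u2 pk uk iPhi.
  have [phi' phiP'] := lift_conj u2 u1 pk' (is_aut_inv uk) iG.
  have [phiK phiK'] := conj_cancel u1 u2 uk phiP phiP'.
  have k0 := lift_ursubmx0 hUB hB devK sK u1 u2 pk fib.
  pose k' := Aff (ulsubmx (lin k)) (usubmx (trans k)).
  have kk' (v : 'cV[R]_(m + l)) : usubmx (app k v) = app k' (usubmx v).
    exact: lower_usub.
  have uk' : is_aut k' by exact: lower_aut.
  (* [k'] descends to [B]: it respects the fibres of the projection R^m -> B because [Phi] does, and
     so does its inverse because of [G]. *)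
  have [beta abeta betaP] : exists2 beta : B -> B, affine_isom beta &
      forall z, beta (uproj (s z)) = uproj (s (app k' z)).
    apply: (descend_isom hB hB uk' apB lpB spB apB lpB spB) => z z'.
    have [[v <-] [w <-]] := (@total_usub R m l z, @total_usub R m l z').
    rewrite -!kk'; split; first exact: (base_compat u1 u2 pk fib).
    move=> e; have := base_compat u2 u1 pk' fib' e.
    by rewrite !appK.
  pose kB := s \o app k' \o @dev R m B UB.
  have rhoBk g x : rhoB (pr (phi g)) (kB x) = kB (rhoB (pr g) x).
    have [v vx] := @total_usub R m l (dev x : 'cV[R]_m).
    rewrite -[LHS]devK /kB /= -vx -kk' -(un_pr u2) phiP kk' (un_pr u1).
    by rewrite vx devK.
  have kBinj : injective kB.
    by move=> x y /(can_inj sK)/(can_inj (appK uk'))/(can_inj devK).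
  (* [phi] preserves pi_1(F), so that [k] descends to the quotients [E1] and [E2]. One direction
     uses that [kB] is onto, the other that it is injective. *)
  have piFphi g : piF pr g <-> piF pr (phi g).
    split=> /= gN.
      apply: (pi1_inj hrhoB); apply/funext => x; rewrite (rhoB1 hrhoB).
      have xE : x = kB (s (app (aff_inv k') (dev x))).
        by rewrite /kB /= sK appVK// devK.
      by rewrite {1}xE rhoBk gN (rhoB1 hrhoB) -xE.
    apply: (pi1_inj hrhoB); apply/funext => x; rewrite (rhoB1 hrhoB).
    by apply: kBinj; rewrite -rhoBk gN (rhoB1 hrhoB).
  have [E1a q1a q1l q1s q1E] := bs_quotient hf1.
  have [E2a q2a q2l q2s q2E] := bs_quotient hf2.
  have [Psi aPsi PsiP] : exists2 Psi : E1 -> E2, affine_isom Psi &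
      forall v, Psi (q1 v) = q2 (app k v).
    apply: (descend_isom (affine_manifold_good E1a) (affine_manifold_good E2a) uk
       q1a q1l q1s q2a q2l q2s) => v w; split.
      by move=> /q1E[g gN ->]; apply/q2E; exists (phi g); [exact: (piFphi g).1|rewrite phiP].
    move=> /q2E[g gN e]; apply/q1E; exists (phi' g).
      by apply: (piFphi _).2; rewrite phiK'.
    by apply: (can_inj (appK uk)); rewrite -phiP phiK'.
  (* The two representations are equal, so zero witnesses both class conditions. *)
  have hconj g : h2 (phi g) = aff_conj k (h1 g) by exact: eq_aff_conj.
  have hconj' g : aff_conj k (h1 (phi' g)) = h2 g by rewrite -hconj phiK'.
  exists Psi, k, k', kB, phi, phi'; split; [|split; [|split; [|split; [|split]]]] => //.
  - split=> //.
    + apply: (bundle_isom_over (beta := app k' : Rn R m -> Rn R m)) => //.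
        exact: can_inj (appK uk').
      move=> x; have [v _ <-] : range q1 x by rewrite q1s.
      by rewrite PsiP (bs_hat hf1) (bs_hat hf2).
    + split=> //.
      * move=> x; apply: continuous_comp; first exact: cdev.
        by apply: continuous_comp; [exact: app_continuous|exact: cs].
      * by move=> x; rewrite /kB /= sK.
      * by exists beta => // x; rewrite /kB /= -betaP devK.
  - by split=> //; exact: (conj_morph u1 u2 uk phiP).
  - by move=> g; rewrite hconj.
  - by exists 0 => g; rewrite hconj' subrr mulmx0 mul0mx subrr.
  - by exists 0 => g; rewrite hconj' subrr mulmx0 subrr.
move=> [_ [k [k' [kB [phi [phi' [[_ uk _ kk' [uk' _ kBdev [beta abeta betaP]]] H]]]]]]].
have [[_ phiK phiK'] [rhoBk [_ [linE _ [e eP]]]]] := H.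
have ibeta : injective beta by case: abeta => ? [/can_inj].
have kBs z : kB (s z) = s (app k' z) by rewrite -[LHS]devK kBdev sK.
pose t : 'cV[R]_(m + l) := col_mx 0 e.
pose K := Aff (lin k) (trans k + t).
have KE v : app K v = app k v + t by rewrite /app /= addrA.
have uK : is_aut K by [].
have usubK (v : 'cV[R]_(m + l)) : usubmx (app K v) = app k' (usubmx v).
  by rewrite KE linearD /= kk' col_mxKu addr0.
(* The linear parts agree by [linE]. The translation parts agree on R^m and differ on R^l by the
   coboundary of [e]; the difference is [lin (h2 (phi g)) *m t - t] because the upper right block of
   [h2] vanishes. *)
have conjE g : aff_conj k (h1 g) =
    Aff (lin (h2 (phi g))) (trans (h2 (phi g)) + (lin (h2 (phi g)) *m t - t)).
  have lE : lin (aff_conj k (h1 g)) = lin (h2 (phi g)) by rewrite linE.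
  rewrite -[LHS]/(Aff (lin (aff_conj k (h1 g))) (trans (aff_conj k (h1 g)))) lE.
  congr Aff; rewrite -[LHS]vsubmxK -[RHS]vsubmxK; congr col_mx.
    (* At the origin, written as [app k w], both maps take their translation vectors as values;
       [un_pr] and [rhoBk] then compare the R^m components. *)
    have [w kw] : exists w, app k w = 0 by exists (app (aff_inv k) 0); rewrite appVK.
    have := un_pr u2 (phi g) (app k w).
    rewrite kk' -kBs rhoBk kBdev -(un_pr u1) -kk' -(app_conj _ w uk) kw.
    rewrite /app !mulmx0 !add0r => <-.
    rewrite linearD linearB /= -(submxK (lin (h2 (phi g)))) mul_block_col lower.
    by rewrite mulmx0 mul0mx addr0 !col_mxKu subrr addr0.
  have := eP (phi g); rewrite phiK /dpart /Bpart => /eqP.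
  rewrite subr_eq => /eqP ->; rewrite linearD linearB /=.
  rewrite -{2}(submxK (lin (h2 (phi g)))) mul_block_col.
  by rewrite !mulmx0 !add0r !col_mxKd addrC.
(* Conjugating further by the translation by [t] adds [t - lin (h2 (phi g)) *m t] to the translation
   part, which cancels the coboundary. *)
have KP g v : app (h2 (phi g)) (app K v) = app K (app (h1 g) v).
  rewrite [RHS]KE -(app_conj _ v uk) conjE KE; move: (app k v) => y.
  by rewrite /app /= mulmxDr -!addrA addNr addr0; congr (_ + _); rewrite addrC.
have [Phi aPhi PhiP] : exists2 Phi : M1 -> M2, affine_isom Phi &
    forall v, Phi (p1 v) = p2 (app K v).
  apply: (descend_isom (un_good u1) (un_good u2) uK (un_affine u1)
    (un_local_diffeo u1) (un_surj u1) (un_affine u2) (un_local_diffeo u2)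
    (un_surj u2)) => v w; split.
    by move=> /(un_orbit u1)[g ->]; apply/(un_orbit u2); exists (phi g); rewrite KP.
  move=> /(un_orbit u2)[g gE]; apply/(un_orbit u1); exists (phi' g).
  by apply: (can_inj (appK uK)); rewrite -KP phiK'.
(* [t] has no R^m component, so [K] still lies over [k'] and [Phi] over [beta]. *)
exists Phi; apply: (bundle_isom_over (beta := beta)) => // x.
have [v _ <-] : range p1 x by rewrite (un_surj u1).
by rewrite PhiP (un_base u1) (un_base u2) usubK -betaP kBs.
Qed.
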